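(* Let $p$ be an odd prime and let $G$ be the GGS-group with a non-constant defining vector $\mathbf{e}\in\mathbb{F}_p^{p-1}$. Then $G$ has the congruence subgroup property and is just infinite.
   Context: Fix an odd prime $p$. Let $X=\{1,\dots,p\}$ and let $T$ be the regular rooted tree whose vertices are the words in the free monoid $X^*$, with $u,v$ joined by an edge if $v=ux$ or $u=vx$ for some $x\in X$. $L_n$ is the set of words of length $n$. $\operatorname{Aut} T$ is the group of automorphisms of $T$ and $\operatorname{st}(n)$ is the stabilizer of all vertices of $L_n$; for $G\le \operatorname{Aut}T$, $\operatorname{st}_G(n)=G\cap\operatorname{st}(n)$. For $g$ fixing a vertex $v$, $g_v\in\operatorname{Aut}T$ denotes the restriction of $g$ to the subtree rooted at $v$ (identified with $T$), i.e. $g(vw)=v\,g_v(w)$; $\psi:\operatorname{st}(1)\to \operatorname{Aut}T\times\overset{p}{\cdots}\times\operatorname{Aut}T$ is the isomorphism $g\mapsto(g_1,\dots,g_p)$. For a non-zero vector $\mathbf{e}=(e_1,\dots,e_{p-1})\in\mathbb{F}_p^{p-1}$, the GGS-group with defining vector $\mathbf{e}$ is $G=\langle a,b\rangle\le\operatorname{Aut}T$, where $a$ is the rooted automorphism given by $a(xv)=\sigma(x)v$ for $x\in X$, $v\in X^*$, with $\sigma=(1\;2\;\dots\;p)$, and $b\in\operatorname{st}(1)$ is recursively defined by $\psi(b)=(a^{e_1},a^{e_2},\dots,a^{e_{p-1}},b)$. The vector is non-constant if its entries $e_1,\dots,e_{p-1}$ are not all equal. A subgroup $G\le\operatorname{Aut}T$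 has the congruence subgroup property if every finite index subgroup of $G$ contains $\operatorname{st}_G(n)$ for some $n$. A group is just infinite if it is infinite and all its quotients by non-trivial normal subgroups are finite. *)

(* Defs.v *)
From HB Require Import structures.
From mathcomp Require Import all_boot all_order all_algebra.
From mathcomp Require Import boolp classical_sets functions cardinality.

Set Implicit Arguments.
Unset Strict Implicit.
Unset Printing Implicit Defensive.

Local Open Scope classical_set_scope.

(* Possibly infinite groups: subgroups of a [groupType] are sets of elements. *)
Section Groups.
Context {T : groupType}.
Implicit Types G H N A : set T.
Local Open Scope group_scope.

Definition is_subgroup H : Prop :=
  H 1 /\ forall x y, H x -> H y -> H (x * y^-1).

Definition generated A : set T := smallest is_subgroup A.

(* Left cosets [x H] with [x] in [G]; this is the underlying set of the
   quotient group [G / H] when [H] is normal in [G]. *)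
Definition cosets G H : set (set T) :=
  [set [set x * h | h in H] | x in G].

Definition finite_index G H : Prop := finite_set (cosets G H).

Definition is_normal G N : Prop :=
  [/\ is_subgroup N, N `<=` G & forall g x, G g -> N x -> N (g^-1 * x * g)].

Definition just_infinite G : Prop :=
  infinite_set G /\
  forall N, is_normal G N -> N <> [set 1] -> finite_set (cosets G N).

End Groups.

Section Tree.
Variable p : nat.

(* The letter [i : 'I_p] stands for the letter [i + 1] of {1, ..., p}. *)
Notation word := (seq 'I_p).

Definition tree_adj (u v : word) : Prop :=
  exists x, v = rcons u x \/ u = rcons v x.

Record tree_aut := TreeAut {
  aut_fun :> word -> word;
  aut_inv : word -> word;
  autK : cancel aut_fun aut_inv;
  aut_invK : cancel aut_inv aut_fun;
  aut_root : aut_fun [::] = [::];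
  aut_adj : forall u v, tree_adj (aut_fun u) (aut_fun v) <-> tree_adj u v
}.

Lemma tree_autP (f g : tree_aut) : f =1 g -> f = g.
Proof.
case: f g => f f' fK f'K f0 fa [g g' gK g'K g0 ga] /= fg.
have {}fg : f = g by apply/funext.
subst g; have fg' : f' = g'.
  by apply/funext => w; rewrite -{1}[w]g'K fK.
by subst g'; congr TreeAut; apply: Prop_irrelevance.
Qed.

HB.instance Definition _ := gen_eqMixin tree_aut.
HB.instance Definition _ := gen_choiceMixin tree_aut.

Lemma one_adj (u v : word) : tree_adj (id u) (id v) <-> tree_adj u v.
Proof. by []. Qed.

Definition aut1 : tree_aut :=
  @TreeAut id id (fun _ => erefl) (fun _ => erefl) erefl one_adj.

Lemma inv_root (f : tree_aut) : aut_inv f [::] = [::].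
Proof. by rewrite -{1}(aut_root f) autK. Qed.

Lemma inv_adj (f : tree_aut) u v :
  tree_adj (aut_inv f u) (aut_inv f v) <-> tree_adj u v.
Proof. by rewrite -(aut_adj f) !aut_invK. Qed.

Definition autV (f : tree_aut) : tree_aut :=
  @TreeAut _ _ (aut_invK f) (autK f) (inv_root f) (inv_adj f).

Lemma comp_root (f g : tree_aut) : (f \o g) [::] = [::].
Proof. by rewrite /= !aut_root. Qed.

Lemma comp_adj (f g : tree_aut) u v :
  tree_adj ((f \o g) u) ((f \o g) v) <-> tree_adj u v.
Proof. by rewrite /= aut_adj aut_adj. Qed.

(* Left actions: [(f * g) w = f (g w)]. *)
Definition autM (f g : tree_aut) : tree_aut :=
  @TreeAut _ _ (can_comp (autK f) (autK g))
    (can_comp (aut_invK g) (aut_invK f)) (comp_root f g) (@comp_adj f g).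

Lemma autMA : associative autM.
Proof. by move=> f g h; apply: tree_autP. Qed.
Lemma aut1M : left_id aut1 autM.
Proof. by move=> f; apply: tree_autP. Qed.
Lemma autM1 : right_id aut1 autM.
Proof. by move=> f; apply: tree_autP. Qed.
Lemma autVM : left_inverse aut1 autV autM.
Proof. by move=> f; apply: tree_autP => w; apply: autK. Qed.
Lemma autMV : right_inverse aut1 autV autM.
Proof. by move=> f; apply: tree_autP => w; apply: aut_invK. Qed.

HB.instance Definition _ := isGroup.Build tree_aut autMA aut1M autM1 autVM autMV.

Definition level_stab (n : nat) : set tree_aut :=
  [set g | forall w, size w = n -> g w = w].

Definition congruence_subgroup_property (G : set tree_aut) : Prop :=
  forall H, is_subgroup H -> H `<=` G -> finite_index G H ->
    exists n, G `&` level_stab n `<=` H.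

Lemma rcons_adj (f : word -> word) :
  (forall u x, exists y, f (rcons u x) = rcons (f u) y) ->
  forall u v, tree_adj u v -> tree_adj (f u) (f v).
Proof.
move=> fr u v [x [->|->]].
- by have [y ->] := fr u x; exists y; left.
- by have [y ->] := fr v x; exists y; right.
Qed.

Lemma aut_rcons (f : tree_aut) u x : exists y, f (rcons u x) = rcons (f u) y.
Proof.
elim/last_ind: u x => [|u z IH] x.
  have : tree_adj (f [::]) (f [:: x]) by apply/aut_adj; exists x; left.
  rewrite aut_root => -[y [->|]]; first by exists y.
  by case: (f _).
have : tree_adj (f (rcons u z)) (f (rcons (rcons u z) x)).
  by apply/aut_adj; exists x; left.
move=> [y [->|]]; first by exists y.
have [t ->] := IH z => /rcons_inj [/(can_inj (autK f)) E _].
by have /eqP := congr1 size E; rewrite !size_rcons -addn2 -{1}[size u]addn0 eqn_add2l.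
Qed.

(* The rooted automorphism: [ordS] is the cyclic permutation (1 2 ... p). *)
Definition rooted_fun (s : 'I_p -> 'I_p) (w : word) : word :=
  if w is x :: v then s x :: v else [::].

Lemma rooted_rcons s u x :
  exists y, rooted_fun s (rcons u x) = rcons (rooted_fun s u) y.
Proof. by case: u => [|z u] /=; [exists (s x) | exists x]. Qed.

Lemma rootedK s t : cancel s t -> cancel (rooted_fun s) (rooted_fun t).
Proof. by move=> sK [|x v] //=; rewrite sK. Qed.

Lemma rcons_adjP (f g : word -> word) : cancel f g ->
  (forall u x, exists y, f (rcons u x) = rcons (f u) y) ->
  (forall u x, exists y, g (rcons u x) = rcons (g u) y) ->
  forall u v, tree_adj (f u) (f v) <-> tree_adj u v.
Proof.
move=> fK fr gr u v; split; last exact: rcons_adj.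
by move=> /(rcons_adj gr); rewrite !fK.
Qed.

Definition ggs_a : tree_aut :=
  @TreeAut _ _ (rootedK (@ordSK p)) (rootedK (@ord_predK p)) erefl
    (rcons_adjP (rootedK (@ordSK p)) (@rooted_rcons _) (@rooted_rcons _)).

(* [insub x] is [Some i] with [i = x] when [x < p - 1], and [None] when [x] is
   the last letter.  [directed_fun s] fixes the first level, acts on the
   subtree below the [i]-th letter as [s i], and recurses on the last one. *)
Fixpoint directed_fun (s : 'I_p.-1 -> tree_aut) (w : word) : word :=
  if w is x :: v then
    x :: (if insub (x : nat) is Some i then s i v else directed_fun s v)
  else [::].

Lemma directedK (s t : 'I_p.-1 -> tree_aut) : (forall i, cancel (s i) (t i)) ->
  cancel (directed_fun s) (directed_fun t).
Proof.
move=> sK; elim=> [|x v IH] //=; congr cons.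
by case: insub => [i|]; [apply: sK | apply: IH].
Qed.

Lemma directed_rcons s u x :
  exists y, directed_fun s (rcons u x) = rcons (directed_fun s u) y.
Proof.
elim: u => [|z u [y IH]] /=.
  by exists x; case: insub => [i|] //=; rewrite aut_root.
case: insub => [i|]; last by rewrite IH; exists y.
by have [t ->] := aut_rcons (s i) u x; exists t.
Qed.

Lemma directedVK s : cancel (directed_fun s) (directed_fun (fun i => autV (s i))).
Proof. by apply: directedK => i w; apply: autK. Qed.

Lemma directedKV s : cancel (directed_fun (fun i => autV (s i))) (directed_fun s).
Proof. by apply: directedK => i w; apply: aut_invK. Qed.

Definition directed (s : 'I_p.-1 -> tree_aut) : tree_aut :=
  @TreeAut _ _ (directedVK s) (directedKV s) erefl
    (rcons_adjP (directedVK s) (@directed_rcons _) (@directed_rcons _)).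

Definition ggs_b (e : 'rV['F_p]_p.-1) : tree_aut :=
  directed (fun i => (ggs_a ^+ (e ord0 i : nat))%g).

Lemma ggs_aE x v : ggs_a (x :: v) = ordS x :: v.
Proof. by []. Qed.

(* [psi b = (a ^ e_1, ..., a ^ e_(p-1), b)], read off the sections of [b]. *)
Lemma ggs_b_st1 e : level_stab 1 (ggs_b e).
Proof.
case=> [|x [|//]] //= _; congr cons.
by case: insub => //= i; rewrite aut_root.
Qed.

Lemma ggs_b_section e (x : 'I_p) (i : 'I_p.-1) v :
  x = i :> nat -> ggs_b e (x :: v) = x :: (ggs_a ^+ (e ord0 i : nat))%g v.
Proof. by move=> xi /=; rewrite xi valK. Qed.

Lemma ggs_b_last e (x : 'I_p) v :
  x = p.-1 :> nat -> ggs_b e (x :: v) = x :: ggs_b e v.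
Proof. by move=> xp /=; rewrite insubF // xp ltnn. Qed.

(* The exponents [e_i] only matter modulo [p]. *)
Lemma ggs_a_exp : (ggs_a ^+ p = 1)%g.
Proof.
have aX n (x : 'I_p) v : exists2 y : 'I_p,
    (ggs_a ^+ n)%g (x :: v) = y :: v & y = (x + n) %% p :> nat.
  elim: n => [|n [y E yE]]; first by exists x; rewrite // addn0 modn_small.
  exists (ordS y); first by rewrite expgS; have /= -> := congr1 ggs_a E.
  by rewrite /= yE -addn1 modnDml addn1 addnS.
apply: tree_autP => -[|x v]; first by rewrite aut_root.
have [y -> yE] := aX p x v; congr cons; apply: val_inj.
by rewrite /= yE modnDr modn_small.
Qed.

Definition ggs_group (e : 'rV['F_p]_p.-1) : set tree_aut :=
  generated [set ggs_a; ggs_b e].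

Definition nonconstant (e : 'rV['F_p]_p.-1) : Prop :=
  ~ (forall i j, e ord0 i = e ord0 j).

End Tree.

(* Main.v *)
(* Write S for the first level stabilizer of G and K@v for the copy of K acting
   on the subtree below v.  Commutators of conjugates of b are supported on two
   letters; commuting them with elements of S trivial on one of these letters
   yields the branching gamma_3(G)@x <= gamma_4(G).  An element of S is a
   product of conjugates of b, and the a-exponents of its sections are the
   convolution of e with the list of conjugates used; since e is not constant,
   finite differences show that elements of st_G(2) lie in gamma_3(G).  Hence
   st_G(3) <= gamma_4(G).  Finally, if a normal subgroup N moves a vertex u, then
   double commutators with gamma_3(G)@u and gamma_3(G)@u00 put gamma_4(G)@u00
   into N, because the section at 00 maps the stabilizer of 00 in gamma_3(G) onto
   G.  So N contains a level stabilizer. *)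

(* Both properties reduce to one fact: a non-trivial normal subgroup of G contains some st_G(n).
   Such a subgroup has finite index because L_n is finite. For the congruence property the fact is
   applied to the normal core of a finite index subgroup, which is non-trivial because G is
   infinite. The branching has to gain one step of the lower central series because the double
   commutators only put [gamma_3(G), G] into N. Its obstacle is the second letter in the support of
   a commutator of conjugates of b. An element of S trivial there is built from two conjugates of b
   whose exponents cancel; it leaves a usable power of a at the first letter unless f(m) f(D) = f(m
   - D) f(2D), where f gives the exponents. The exceptions are a vanishing exponent, where the
   second letter drops out of the support, and p = 3 with e_2 = - e_1, the Gupta-Sidki group, where
   three commutators combine to an element supported on one letter. *)
Require Import Defs.
From mathcomp Require Import all_boot all_order all_algebra.
From mathcomp Require Import boolp classical_sets functions cardinality.

Set Implicit Arguments.
Unset Strict Implicit.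
Unset Printing Implicit Defensive.

Import GRing.Theory.
Local Open Scope classical_set_scope.
Local Open Scope group_scope.

(** * Commutator subgroups and congruences modulo a normal subgroup *)

Section GroupSets.
Context {T : groupType}.
Implicit Types (G H N A B : set T) (x y z g : T).

Lemma is_subgroup1 H : is_subgroup H -> H 1.
Proof. by case. Qed.

Lemma is_subgroupV H x : is_subgroup H -> H x -> H x^-1.
Proof. by move=> [H1 HV] Hx; rewrite -[x^-1]mul1g; apply: HV. Qed.

Lemma is_subgroupM H x y : is_subgroup H -> H x -> H y -> H (x * y).
Proof. by move=> sH Hx Hy; rewrite -[y]invgK; apply: sH.2 => //; apply: is_subgroupV. Qed.

Lemma is_subgroupX H x n : is_subgroup H -> H x -> H (x ^+ n).
Proof.
move=> sH Hx; elim: n => [|n IH]; first exact: is_subgroup1.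
by rewrite expgS; apply: is_subgroupM.
Qed.

Lemma is_subgroupJ H x y : is_subgroup H -> H x -> H y -> H (x ^ y).
Proof.
by move=> sH Hx Hy; rewrite conjgE; do ?apply: is_subgroupM => //; apply: is_subgroupV.
Qed.

Lemma is_subgroupR H x y : is_subgroup H -> H x -> H y -> H [~ x, y].
Proof.
by move=> sH Hx Hy; rewrite commgEl; apply: is_subgroupM => //;
  [apply: is_subgroupV | apply: is_subgroupJ].
Qed.

Lemma is_subgroup_ind H : H 1 -> (forall x y, H x -> H y -> H (x * y)) ->
  (forall x, H x -> H x^-1) -> is_subgroup H.
Proof. by move=> H1 HM HV; split=> // x y Hx Hy; apply: HM => //; apply: HV. Qed.

Lemma generated_subgroup A : is_subgroup (generated A).
Proof.
split=> [B [[]] //|x y Ax Ay B [sB AB]].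
by apply: sB.2; [apply: Ax | apply: Ay].
Qed.

Lemma mem_generated A x : A x -> generated A x.
Proof. exact: sub_gen_smallest. Qed.

Lemma generated_sub A H : is_subgroup H -> A `<=` H -> generated A `<=` H.
Proof. exact: smallest_sub. Qed.

Definition normalized G N := forall g x, G g -> N x -> N (x ^ g).

Lemma is_normalE G N :
  is_normal G N <-> [/\ is_subgroup N, N `<=` G & normalized G N].
Proof.
split=> -[sN NG nN]; split=> // g x Gg Nx; have := nN g x Gg Nx;
  by rewrite ?conjgE mulgA.
Qed.

Definition comm_sub A B : set T :=
  generated [set z | exists x y, [/\ A x, B y & z = [~ x, y]]].

Lemma comm_sub_subgroup A B : is_subgroup (comm_sub A B).
Proof. exact: generated_subgroup. Qed.

Lemma mem_comm_sub A B x y : A x -> B y -> comm_sub A B [~ x, y].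
Proof. by move=> Ax By; apply: mem_generated; exists x, y. Qed.

Lemma comm_sub_le A B N : is_subgroup N ->
  (forall x y, A x -> B y -> N [~ x, y]) -> comm_sub A B `<=` N.
Proof.
by move=> sN AB; apply: generated_sub => // _ [x [y [Ax By ->]]]; apply: AB.
Qed.

Lemma preimage_conj_subgroup H g : is_subgroup H -> is_subgroup [set x | H (x ^ g)].
Proof.
move=> sH; apply: is_subgroup_ind => /= [|x y|x]; rewrite ?conj1g ?conjMg ?conjVg.
- exact: is_subgroup1.
- exact: is_subgroupM.
- exact: is_subgroupV.
Qed.

Lemma comm_sub_normalized G A B :
  normalized G A -> normalized G B -> normalized G (comm_sub A B).
Proof.
move=> nA nB g x Gg.
suff: comm_sub A B `<=` [set x | comm_sub A B (x ^ g)] by apply.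
apply: comm_sub_le => [|{}x y Ax By].
  exact/preimage_conj_subgroup/comm_sub_subgroup.
by rewrite /= conjRg; apply: mem_comm_sub; [apply: nA | apply: nB].
Qed.

Lemma comm_sub_normal_sub G N : is_normal G N -> is_subgroup G -> comm_sub N G `<=` N.
Proof.
move=> /is_normalE[sN _ nN] sG; apply: comm_sub_le => // x y Nx Gy.
by rewrite commgEl; apply: is_subgroupM; [|apply: is_subgroupV|apply: nN].
Qed.

Lemma subgroup_normal G : is_subgroup G -> is_normal G G.
Proof. by move=> sG; apply/is_normalE; split=> // g x Gg Gx; apply: is_subgroupJ. Qed.

Lemma comm_sub_normal G N : is_subgroup G -> is_normal G N -> is_normal G (comm_sub N G).
Proof.
move=> sG nN; apply/is_normalE; split; first exact: comm_sub_subgroup.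
- by move=> x /(comm_sub_normal_sub nN sG); case: nN => _ + _; apply.
- apply: comm_sub_normalized; first by case/is_normalE: nN.
  by case/is_normalE: (subgroup_normal sG).
Qed.

Lemma commgMr x y z : [~ x, y * z] = [~ x, z] * [~ x, y] ^ z.
Proof.
by rewrite !commgEl !conjgE !(invgM, invgK, mulgA, mulgK, mulgVK).
Qed.

Lemma commgMl x y z : [~ x * y, z] = [~ x, z] ^ y * [~ y, z].
Proof.
by rewrite !commgEl !conjgE !(invgM, invgK, mulgA, mulgK, mulgVK).
Qed.

Lemma commgVr x y : [~ x, y^-1] = ([~ x, y]^-1) ^ y^-1.
Proof.
by rewrite !commgEl !conjgE !(invgM, invgK, mulgA, mulgK, mulgVK, mulgV, mul1g).
Qed.

Lemma commgVl x y : [~ x^-1, y] = ([~ x, y]^-1) ^ x^-1.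
Proof.
by rewrite !commgEl !conjgE !(invgM, invgK, mulgA, mulgK, mulgVK, mulgV, mul1g).
Qed.

Section Modulo.
Variables (G N : set T).
Hypotheses (sG : is_subgroup G) (nN : is_normal G N).

Let sN : is_subgroup N. Proof. by case/is_normalE: nN. Qed.
Let NJ : normalized G N. Proof. by case/is_normalE: nN. Qed.

(** The centralizer of [x] modulo [N]. Being a subgroup, it need only be tested on generators of
    [G]. *)
Lemma comm_mem_r x : G x -> is_subgroup [set y | G y /\ N [~ x, y]].
Proof.
move=> Gx; apply: is_subgroup_ind => /=.
- by split; [apply: is_subgroup1 | rewrite commg1; apply: is_subgroup1].
- move=> y z [Gy Ny] [Gz Nz]; split; first exact: is_subgroupM.
  by rewrite commgMr; apply: is_subgroupM => //; apply: NJ.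
- move=> y [Gy Ny]; split; first exact: is_subgroupV.
  by rewrite commgVr; apply: NJ; apply: is_subgroupV.
Qed.

Lemma comm_mem_l : is_subgroup [set x | G x /\ forall y, G y -> N [~ x, y]].
Proof.
apply: is_subgroup_ind => /=.
- by split=> [|y Gy]; [apply: is_subgroup1 | rewrite comm1g; apply: is_subgroup1].
- move=> y z [Gy Ny] [Gz Nz]; split=> [|g Gg]; first exact: is_subgroupM.
  by rewrite commgMl; apply: is_subgroupM => //; [apply: NJ => // |]; auto.
- move=> y [Gy Ny]; split=> [|g Gg]; first exact: is_subgroupV.
  by rewrite commgVl; apply: NJ; apply: is_subgroupV => //; apply: Ny.
Qed.

Definition center_mod := [set x | G x /\ forall y, G y -> N [~ x, y]].

Lemma center_mod_normal : is_normal G center_mod.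
Proof.
apply/is_normalE; split; [exact: comm_mem_l | by move=> x [] | ].
move=> g x Gg [Gx Nx]; split=> [|y Gy]; first exact: is_subgroupJ.
rewrite -[y](conjgKV g) -conjRg; apply: NJ => //; apply: Nx.
by apply: is_subgroupJ => //; apply: is_subgroupV.
Qed.

Definition eqm x y := N (x^-1 * y).

Lemma eqm_refl x : eqm x x.
Proof. by rewrite /eqm mulVg; apply: is_subgroup1. Qed.

Lemma eqm_sym x y : eqm x y -> eqm y x.
Proof. by move=> /(is_subgroupV sN); rewrite /eqm invgM invgK. Qed.

Lemma eqm_trans y x z : eqm x y -> eqm y z -> eqm x z.
Proof.
move=> xy yz; have := is_subgroupM sN xy yz.
by rewrite /eqm !mulgA mulgK.
Qed.

Lemma eqmM x y x' y' : G y -> eqm x x' -> eqm y y' -> eqm (x * y) (x' * y').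
Proof.
move=> Gy xx yy; have := is_subgroupM sN (NJ Gy xx) yy.
by rewrite /eqm conjgE !invgM !mulgA mulgK.
Qed.

Lemma eqm_comm x y : N [~ y, x] -> eqm (x * y) (y * x).
Proof. by rewrite /eqm commgEl conjgE invgM !mulgA. Qed.

End Modulo.

(** The images of the generators commute in G / N, so this quotient is abelian. *)
Lemma comm_sub2_le G N A : is_subgroup G -> is_normal G N -> G = generated A ->
  (forall x y, A x -> A y -> N [~ x, y]) -> comm_sub G G `<=` N.
Proof.
move=> sG nN GA AN; case/is_normalE: (nN) => sN _ _.
have AG x : A x -> G x by rewrite GA; apply: mem_generated.
apply: comm_sub_le => // x y Gx; move: y; suff [] : center_mod G N x by [].
move: Gx; rewrite {1}GA; move: x; apply: generated_sub.
  exact: comm_mem_l.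
move=> x Ax; split; first exact: AG.
suff GN : G `<=` [set y | G y /\ N [~ x, y]] by move=> y /GN[].
rewrite {1}GA; apply: generated_sub; first by apply: comm_mem_r => //; apply: AG.
by move=> y Ay; split; [apply: AG | apply: AN].
Qed.

(** Commutators of generators commute with generators modulo [N], hence are central modulo [N]; so
    [comm_sub2_le] applies with [center_mod G N] in place of [N]. *)
Lemma comm_sub3_le G N A : is_subgroup G -> is_normal G N -> G = generated A ->
  (forall x y z, A x -> A y -> A z -> N [~ x, y, z]) ->
  comm_sub (comm_sub G G) G `<=` N.
Proof.
move=> sG nN GA AN; case/is_normalE: (nN) => sN _ _.
have AG x : A x -> G x by rewrite GA; apply: mem_generated.
apply: comm_sub_le => // x y G2x; move: y; suff [] : center_mod G N x by [].
move: G2x; move: x; apply: (comm_sub2_le sG (center_mod_normal sG nN) GA).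
move=> x y Ax Ay; have Gxy : G [~ x, y] by apply: is_subgroupR => //; apply: AG.
split=> //.
suff GN : G `<=` [set z | G z /\ N [~ x, y, z]] by move=> z /GN[].
rewrite {1}GA; apply: generated_sub; first exact: comm_mem_r.
by move=> z Az; split; [apply: AG | apply: AN].
Qed.

End GroupSets.

(** * Automorphisms given by their sections, and grafts below a vertex *)

Section Spread.
Variable p : nat.
Local Notation aut := (tree_aut p).
Implicit Types (h : 'I_p -> aut) (f g k : aut) (u v w : seq 'I_p) (x y : 'I_p).

Lemma autE f g w : (f * g) w = f (g w). Proof. by []. Qed.
Lemma aut_KV f w : f^-1 (f w) = w. Proof. by rewrite -autE mulVg. Qed.

Lemma aut_fixV f w : f w = w -> f^-1 w = w.
Proof. by move=> fw; rewrite -{1}fw aut_KV. Qed.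

Lemma size_aut f w : size (f w) = size w.
Proof.
elim/last_ind: w => [|w x IH]; first by rewrite aut_root.
by have [y ->] := aut_rcons f w x; rewrite !size_rcons IH.
Qed.

Lemma aut_cat f u v : exists2 v', f (u ++ v) = f u ++ v' & size v' = size v.
Proof.
elim/last_ind: v => [|v x [v' E sv]]; first by exists [::]; rewrite ?cats0.
have [y Ey] := aut_rcons f (u ++ v) x.
by exists (rcons v' y); rewrite ?size_rcons ?sv // -!rcons_cat Ey E rcons_cat.
Qed.

Definition spread_fun h w := if w is x :: v then x :: h x v else [::].

Lemma spread_rcons h u x : exists y, spread_fun h (rcons u x) = rcons (spread_fun h u) y.
Proof.
case: u => [|z u] /=; first by exists x; rewrite aut_root.
by have [t ->] := aut_rcons (h z) u x; exists t.
Qed.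

Lemma spread_funK h : cancel (spread_fun h) (spread_fun (fun x => (h x)^-1)).
Proof. by case=> //= x v; congr cons; apply: autK. Qed.

Lemma spread_funVK h : cancel (spread_fun (fun x => (h x)^-1)) (spread_fun h).
Proof. by case=> //= x v; congr cons; apply: aut_invK. Qed.

(* The isomorphism from [Aut T ^ X] onto the first level stabilizer, the
   inverse of the paper's psi. *)
Definition spread h : aut :=
  @TreeAut _ _ _ (spread_funK h) (spread_funVK h) erefl
    (rcons_adjP (spread_funK h) (@spread_rcons h) (@spread_rcons _)).

Lemma spreadE h x v : spread h (x :: v) = x :: h x v. Proof. by []. Qed.

Lemma spread_ext h h' : h =1 h' -> spread h = spread h'.
Proof. by move=> hh; apply: tree_autP => -[|x v] //=; rewrite hh. Qed.

Lemma spread_inj h h' : spread h = spread h' -> h =1 h'.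
Proof.
move=> hh x; apply: tree_autP => v.
by have := congr1 (fun f : aut => f (x :: v)) hh; rewrite !spreadE => -[].
Qed.

Lemma spread1 : spread (fun=> 1) = 1.
Proof. by apply: tree_autP => -[]. Qed.

Lemma spreadM h h' : spread h * spread h' = spread (fun x => h x * h' x).
Proof. by apply: tree_autP => -[]. Qed.

Lemma spreadV h : (spread h)^-1 = spread (fun x => (h x)^-1).
Proof. by apply: tree_autP => -[]. Qed.

Lemma spreadJ h h' : spread h ^ spread h' = spread (fun x => h x ^ h' x).
Proof. by rewrite conjgE spreadV !spreadM. Qed.

Lemma spreadR h h' : [~ spread h, spread h'] = spread (fun x => [~ h x, h' x]).
Proof. by rewrite commgEl spreadJ spreadV spreadM. Qed.

Lemma spreadX h n : spread h ^+ n = spread (fun x => h x ^+ n).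
Proof.
elim: n => [|n IH]; first by rewrite expg0 -spread1; apply: spread_ext.
by rewrite expgS IH spreadM; apply: spread_ext => x; rewrite expgS.
Qed.

Definition graft x k : aut := spread (fun y => if y == x then k else 1).

Lemma graftM x k k' : graft x k * graft x k' = graft x (k * k').
Proof. by rewrite spreadM; apply: spread_ext => y; case: eqP => _; rewrite ?mulg1. Qed.

Lemma graft1 x : graft x 1 = 1.
Proof. by rewrite -[RHS]spread1; apply: spread_ext => y; case: eqP. Qed.

Lemma graftV x k : (graft x k)^-1 = graft x k^-1.
Proof. by apply: (mulgI (graft x k)); rewrite mulgV graftM mulgV graft1. Qed.

Lemma graft_spreadJ x k h : graft x k ^ spread h = graft x (k ^ h x).
Proof. by rewrite spreadJ; apply: spread_ext => y; case: eqP => [->|_]; rewrite ?conj1g. Qed.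

Lemma graft_spreadR x k h : [~ graft x k, spread h] = graft x [~ k, h x].
Proof. by rewrite commgEl graft_spreadJ graftV graftM -commgEl. Qed.

(** For [k] in K these are the elements of K@u. *)
Fixpoint graftw u k : aut := if u is x :: u' then graft x (graftw u' k) else k.

Lemma graftwM u k k' : graftw u k * graftw u k' = graftw u (k * k').
Proof. by elim: u => //= x u IH; rewrite graftM IH. Qed.

Lemma graftw1 u : graftw u 1 = 1.
Proof. by elim: u => //= x u ->; rewrite graft1. Qed.

Lemma graftwV u k : (graftw u k)^-1 = graftw u k^-1.
Proof. by apply: (mulgI (graftw u k)); rewrite mulgV graftwM mulgV graftw1. Qed.

Lemma graftwJ u k k' : graftw u k ^ graftw u k' = graftw u (k ^ k').
Proof. by rewrite conjgE graftwV !graftwM. Qed.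

Lemma graftwR u k k' : [~ graftw u k, graftw u k'] = graftw u [~ k, k'].
Proof. by rewrite commgEl graftwV graftwJ graftwM. Qed.

Lemma graftw_cat u v k : graftw (u ++ v) k = graftw u (graftw v k).
Proof. by elim: u => //= x u ->. Qed.

Lemma graftwE u k w : graftw u k (u ++ w) = u ++ k w.
Proof. by elim: u => //= x u; rewrite eqxx => ->. Qed.

Lemma graftw_out u k w : ~~ prefix u w -> graftw u k w = w.
Proof.
elim: u w => [|x u IH] [|y w] //=; rewrite [y == x]eq_sym.
by case: eqP => //= _ nw; rewrite IH.
Qed.

Lemma graftw_preim u H : is_subgroup H -> is_subgroup [set k | H (graftw u k)].
Proof.
move=> sH; apply: is_subgroup_ind => /= [|k k'|k].
- by rewrite graftw1; apply: is_subgroup1.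
- by rewrite -graftwM; apply: is_subgroupM.
- by rewrite -graftwV; apply: is_subgroupV.
Qed.

(* The left factor fixes the subtree at [u] pointwise, since [g] moves [u]. *)
Lemma graftw_commute g u k k' : g u <> u -> commute (graftw u k ^ g) (graftw u k').
Proof.
move=> gu; set X := graftw u k ^ g; set Y := graftw u k'.
have XE t : X (u ++ t) = u ++ t.
  have [t' E _] := aut_cat g u t.
  rewrite /X conjgE !autE E graftw_out -?E ?aut_KV // E.
  apply/negP => /prefixP[s] /eqP; rewrite eqseq_cat ?size_aut // => /andP[/eqP].
  by [].
clearbody X; apply: tree_autP => w; rewrite !autE.
have [/prefixP[t ->]|nw] := boolP (prefix u w).
  by rewrite XE /Y graftwE XE.
have -> : Y w = w by apply: graftw_out.
symmetry; apply: graftw_out.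
apply: contra nw => /prefixP[t E].
(* If [X w] were below [u], the inverse of [X] would fix it, and [w = X w] would be below [u]. *)
by rewrite -(aut_KV X w) E aut_fixV ?XE // prefix_prefix.
Qed.

Lemma section_subgroup H x : is_subgroup H ->
  is_subgroup [set g | exists h, H (spread h) /\ h x = g].
Proof.
move=> sH; apply: is_subgroup_ind => /=.
- by exists (fun=> 1); rewrite spread1; split=> //; apply: (is_subgroup1 sH).
- move=> g g' [h [Gh <-]] [h' [Gh' <-]]; exists (fun y => h y * h' y).
  by rewrite -spreadM; split=> //; apply: (is_subgroupM sH).
- move=> g [h [Gh <-]]; exists (fun y => (h y)^-1).
  by rewrite -spreadV; split=> //; apply: (is_subgroupV sH).
Qed.

Lemma level_stabE n g w : level_stab n g -> (size w <= n)%N -> g w = w.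
Proof.
case: w => [|x w] gn wn; first by rewrite aut_root.
(* [level_stab n] speaks only of words of length exactly [n], so the word is padded; prefixes of a
   fixed word are fixed. *)
have := gn ((x :: w) ++ nseq (n - size (x :: w)) x).
rewrite size_cat size_nseq subnKC // => /(_ erefl).
have [t -> _] := aut_cat g (x :: w) (nseq (n - size (x :: w)) x).
by move/eqP; rewrite eqseq_cat ?size_aut // => /andP[/eqP].
Qed.

Lemma level_stab_mono m n : (m <= n)%N -> @level_stab p n `<=` level_stab m.
Proof. by move=> mn g gn w wm; apply: (level_stabE gn); rewrite wm. Qed.

Lemma level_stab_spread n h x : level_stab n.+1 (spread h) -> level_stab n (h x).
Proof. by move=> gn w wn; have := gn (x :: w); rewrite spreadE /= wn => /(_ erefl)[]. Qed.

(** [spread h] is the product of the grafts of its sections; a duplicate-free list of letters makes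
    each factor occur once. *)
Lemma spread_graft_mem H u h : is_subgroup H ->
  (forall x, H (graftw (rcons u x) (h x))) -> H (graftw u (spread h)).
Proof.
move=> sH Hh.
suff E (s : seq 'I_p) : uniq s ->
    H (graftw u (spread (fun y => if y \in s then h y else 1))).
  have := E (enum 'I_p) (enum_uniq _); congr (H (graftw u _)).
  by apply: spread_ext => y; rewrite mem_enum.
elim: s => [_|x s IH /= /andP[xs /IH Hs]].
  by rewrite (@spread_ext _ (fun=> 1)) // spread1 graftw1; apply: is_subgroup1.
have := is_subgroupM sH (Hh x) Hs.
rewrite -cats1 graftw_cat graftwM; congr (H (graftw u _)).
rewrite spreadM; apply: spread_ext => y; rewrite inE.
by case: eqP => [->|_]; rewrite ?(negPf xs) ?mulg1 ?mul1g.
Qed.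

End Spread.

(** * Conjugates of b and a normal form for the elements of G *)

Section GGS.
Variable q : nat.
Local Notation p := q.+2.
Variable e : 'rV['F_p]_p.-1.
Local Notation aut := (tree_aut p).
Local Notation a := (@ggs_a p).
Local Notation b := (@ggs_b p e).
Local Notation G := (ggs_group e).
Local Notation G2 := (comm_sub G G).
Local Notation G3 := (comm_sub G2 G).
Local Notation G4 := (comm_sub G3 G).
Implicit Types (h : 'I_p -> aut) (f g k : aut) (u v w : seq 'I_p) (i j m x y : 'I_p).

Lemma expg_modn (T : groupType) (z : T) r n : z ^+ r = 1 -> z ^+ (n %% r) = z ^+ n.
Proof. by move=> zr; rewrite {2}(divn_eq n r) expgnDr mulnC expgnA zr expg1n mul1g. Qed.

Lemma expg_ZpD (T : groupType) (z : T) i j : z ^+ p = 1 ->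
  z ^+ (i + j)%R = z ^+ i * z ^+ j.
Proof. by move=> zp; rewrite -expgnDr -[RHS](expg_modn _ zp). Qed.

Lemma expg_ZpM (T : groupType) (z : T) i j : z ^+ p = 1 ->
  z ^+ (i * j)%R = z ^+ i ^+ j.
Proof. by move=> zp; rewrite -expgnA -[RHS](expg_modn _ zp). Qed.

Lemma expg_Zp1 (T : groupType) (z : T) : z ^+ (1%R : 'I_p) = z.
Proof. by rewrite /= expg1. Qed.

Lemma expg_ZpV (T : groupType) (z : T) i : z ^+ p = 1 ->
  z ^+ (- i)%R = (z ^+ i)^-1.
Proof.
move=> zp; apply: (mulgI (z ^+ i)).
by rewrite mulgV -expg_ZpD // subrr.
Qed.

Let aP : a ^+ p = 1 := ggs_a_exp p.

Lemma val_Zp_succ x : (x + 1)%R = x.+1 %% p :> nat.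
Proof. by rewrite /= modnDmr addn1. Qed.

Lemma ggs_aXE i x v : (a ^+ i) (x :: v) = (x + i)%R :: v.
Proof.
have H n : (a ^+ n) (x :: v) = (x + n%:R)%R :: v.
  elim: n => [|n IH]; first by rewrite addr0.
  rewrite expgS autE IH ggs_aE -natr1 addrA; congr cons.
  by apply: val_inj; rewrite [RHS]val_Zp_succ.
by rewrite H Zp_nat valZpK.
Qed.

Lemma spread_aJ h i : spread h ^ (a ^+ i) = spread (fun x => h (x + i)%R).
Proof.
rewrite conjgE -expg_ZpV //; apply: tree_autP => -[|x v].
  by rewrite !autE !aut_root.
by rewrite !autE ggs_aXE !spreadE ggs_aXE addrK.
Qed.

(* With letters numbered 1, ..., p as in the paper and read modulo p, [ggs_eps m]
   is the exponent e_m (and junk 0 at m = 0), and [ggs_be m] is the section of b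
   at the letter m. *)
Definition ggs_eps m : 'I_p :=
  if m == 0%R then 0%R else inZp (e ord0 (inord m.-1) : nat).

Definition ggs_be m : aut := if m == 0%R then b else a ^+ (ggs_eps m).

Lemma ggs_beN m : m != 0%R -> ggs_be m = a ^+ ggs_eps m.
Proof. by rewrite /ggs_be; case: eqP. Qed.

Lemma ggs_b_spread : b = spread (fun x => ggs_be (x + 1)%R).
Proof.
apply: tree_autP => -[|x v] //; rewrite spreadE /ggs_be.
have [x1|x1] := eqVneq.
  apply: ggs_b_last; have := congr1 val x1; rewrite [val _]val_Zp_succ /=.
  have := ltn_ord x; rewrite ltnS leq_eqVlt => /orP[/eqP //|xq].
  by rewrite modn_small.
have xq : x < q.+1.
  rewrite ltn_neqAle -ltnS ltn_ord andbT; apply: contraNneq x1 => xq.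
  by apply/eqP/val_inj; rewrite [LHS]val_Zp_succ xq modnn.
rewrite (@ggs_b_section _ e x (Ordinal xq)) // /ggs_eps (negPf x1) expg_modn //.
have -> : inord (nat_of_ord (x + 1)%R).-1 = Ordinal xq :> 'I_q.+1 by
  apply: val_inj; rewrite val_Zp_succ modn_small // /= inordK.
by [].
Qed.

(** At the last letter the section of b^p is b^p again, hence the induction on the word; at the
    others it is a power of a^p. *)
Lemma ggs_bP : b ^+ p = 1.
Proof.
apply: tree_autP; elim=> [|x v IH]; first by rewrite aut_root.
rewrite ggs_b_spread spreadX spreadE /ggs_be; congr cons.
by case: eqP => // _; rewrite -expgnA mulnC expgnA aP expg1n.
Qed.

(* The conjugate of b by a power of a whose section at [i] is b. *)
Definition ggs_bb i : aut := spread (fun x => ggs_be (x - i)%R).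

Lemma bb_aJ i j : ggs_bb i ^ (a ^+ j) = ggs_bb (i - j)%R.
Proof. by rewrite spread_aJ; apply: spread_ext => x; congr ggs_be; rewrite opprB addrA addrAC. Qed.

(** The last letter, where b has section b, is -1 modulo p. *)
Lemma ggs_bE : b = ggs_bb (-1)%R.
Proof. by rewrite ggs_b_spread; apply: spread_ext => x; rewrite opprK. Qed.

Lemma bbE i : ggs_bb i = ggs_bb 0%R ^ (a ^+ (- i)%R).
Proof. by rewrite bb_aJ opprK add0r. Qed.

Lemma bbP i : ggs_bb i ^+ p = 1.
Proof.
have E : ggs_bb i = b ^ (a ^+ (-1 - i)%R).
  by rewrite ggs_bE bb_aJ; congr ggs_bb; rewrite opprB addrC subrK.
by rewrite E -conjXg ggs_bP conj1g.
Qed.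

Lemma ggs_subgroup : is_subgroup G. Proof. exact: generated_subgroup. Qed.
Let sG := ggs_subgroup.

Lemma ggs_group_a : G a. Proof. by apply: mem_generated; left. Qed.
Lemma ggs_group_b : G b. Proof. by apply: mem_generated; right. Qed.
Lemma ggs_group_aX n : G (a ^+ n).
Proof. exact: (is_subgroupX n sG ggs_group_a). Qed.

Lemma ggs_group_bb i : G (ggs_bb i).
Proof.
have E : ggs_bb i = b ^ (a ^+ (-1 - i)%R).
  by rewrite ggs_bE bb_aJ; congr ggs_bb; rewrite opprB addrC subrK.
by rewrite E; apply: (is_subgroupJ sG); [apply: ggs_group_b | apply: ggs_group_aX].
Qed.

Lemma ggs_group_be m : G (ggs_be m).
Proof.
by rewrite /ggs_be; case: eqP => _; [apply: ggs_group_b | apply: ggs_group_aX].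
Qed.

Definition ggs_bbs (l : seq 'I_p) : aut := \prod_(i <- l) ggs_bb i.

Lemma bbs_cat l l' : ggs_bbs (l ++ l') = ggs_bbs l * ggs_bbs l'.
Proof. by rewrite /ggs_bbs big_cat. Qed.

Lemma bbs_cons i l : ggs_bbs (i :: l) = ggs_bb i * ggs_bbs l.
Proof. by rewrite /ggs_bbs big_cons. Qed.

Lemma bbs_aJ l j : ggs_bbs l ^ (a ^+ j) = ggs_bbs [seq (i - j)%R | i <- l].
Proof.
elim: l => [|i l IH]; first by rewrite /ggs_bbs !big_nil conj1g.
by rewrite map_cons !bbs_cons conjMg IH bb_aJ.
Qed.

(** Since b has order dividing p = [q.+2], lists of conjugates describe products without any sign
    for inverses. *)
Lemma bbV_bbs i : (ggs_bb i)^-1 = ggs_bbs (nseq q.+1 i).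
Proof.
have E n : ggs_bbs (nseq n i) = ggs_bb i ^+ n.
  by elim: n => [|n IH]; rewrite ?/ggs_bbs ?big_nil //= -/(ggs_bbs _) bbs_cons IH expgS.
by apply: (mulgI (ggs_bb i)); rewrite mulgV E -expgS bbP.
Qed.

Lemma bbsV l : exists l', (ggs_bbs l)^-1 = ggs_bbs l'.
Proof.
elim: l => [|i l [l' IH]]; first by exists [::]; rewrite /ggs_bbs big_nil invg1.
by exists (l' ++ nseq q.+1 i); rewrite bbs_cons invgM IH bbV_bbs bbs_cat.
Qed.

(** G is the product of the powers of a and the normal closure of b: moving a power of a to the left
    only shifts the list, by [bbs_aJ]. *)
Lemma ggs_groupP g : G g -> exists i l, g = a ^+ i * ggs_bbs l.
Proof.
move: g; apply: generated_sub.
  apply: is_subgroup_ind => /=.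
  - by exists 0%R, [::]; rewrite /ggs_bbs big_nil mulg1 [a ^+ _]expg0.
  - move=> _ _ [i [l ->]] [j [l' ->]].
    exists (i + j)%R, ([seq (t - j)%R | t <- l] ++ l').
    rewrite expg_ZpD // bbs_cat -bbs_aJ conjgE !mulgA; congr (_ * _ * _).
    by rewrite mulgK.
  - move=> _ [i [l ->]]; have [l' E] := bbsV l.
    exists (- i)%R, [seq (t + i)%R | t <- l']; rewrite invgM E expg_ZpV //.
    have -> : [seq (t + i)%R | t <- l'] = [seq (t - - i)%R | t <- l'].
      by apply: eq_map => t; rewrite opprK.
    by rewrite -bbs_aJ expg_ZpV // conjgE invgK !mulgA mulVg mul1g.
move=> _ [->|->].
- exists 1%R, [::]; rewrite /ggs_bbs big_nil mulg1.
  by rewrite expg_Zp1.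
- exists 0%R, [:: (-1)%R]; rewrite /ggs_bbs big_seq1 -ggs_bE.
  by rewrite [a ^+ _]expg0 mul1g.
Qed.

Lemma ggs_group_bbs l : G (ggs_bbs l).
Proof.
elim: l => [|i l IH]; first by rewrite /ggs_bbs big_nil; apply: (is_subgroup1 sG).
by rewrite bbs_cons; exact: (is_subgroupM sG (ggs_group_bb i) IH).
Qed.

Lemma bbs_spread l : ggs_bbs l = spread (fun x => \prod_(i <- l) ggs_be (x - i)%R).
Proof.
elim: l => [|i l IH].
  by rewrite /ggs_bbs big_nil -[LHS]spread1; apply: spread_ext => x; rewrite big_nil.
rewrite bbs_cons IH spreadM; apply: spread_ext => x; rewrite big_cons; by [].
Qed.

Lemma graft_aJ x k i : graft x k ^ (a ^+ i) = graft (x - i)%R k.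
Proof.
rewrite /graft spread_aJ; apply: spread_ext => y.
by rewrite [y == _]eq_sym subr_eq eq_sym.
Qed.

Let nG : is_normal G G := subgroup_normal sG.
Lemma G2_normal : is_normal G G2. Proof. exact: comm_sub_normal. Qed.
Lemma G3_normal : is_normal G G3. Proof. exact/comm_sub_normal/G2_normal. Qed.
Lemma G4_normal : is_normal G G4. Proof. exact/comm_sub_normal/G3_normal. Qed.

End GGS.

(** * Arithmetic modulo p and the case distinction on the exponents *)

Section ZpArith.
Variable q : nat.
Local Notation p := q.+2.
Hypothesis p_prime : prime p.
Local Open Scope ring_scope.
Implicit Types (x y D m : 'I_p) (f : 'I_p -> 'I_p).

Lemma Zp_p_eq0 : p%:R = 0 :> 'I_p.
Proof. by rewrite Zp_nat; apply: val_inj; rewrite /= modnn. Qed.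

Lemma Zp_mulrp x : x *+ p = 0.
Proof. by rewrite -mulr_natl Zp_p_eq0 mul0r. Qed.

Lemma Zp_unit x : x != 0 -> x \is a GRing.unit.
Proof.
move=> x0; rewrite -[x]valZpK -Zp_nat (@unitZpE p) //.
rewrite prime_coprime //; apply: contra x0 => /dvdnP[k E].
apply/eqP/val_inj; case: k E => [|k] E; first exact: E.
by have := ltn_ord x; rewrite E mulSn ltnNge leq_addr.
Qed.

Lemma Zp_mulIf x y z : z != 0 -> x * z = y * z -> x = y.
Proof. by move=> /Zp_unit z0; apply: mulIr. Qed.

Lemma Zp_mulf_neq0 x y : x != 0 -> y != 0 -> x * y != 0.
Proof.
by move=> x0 y0; apply: contra x0 => /eqP E; apply/eqP; apply: (Zp_mulIf y0); rewrite mul0r.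
Qed.

Lemma Zp_fermat x : x ^+ p = x.
Proof.
have pc : p \in [pchar 'I_p] by rewrite inE p_prime Zp_p_eq0 eqxx.
by rewrite -[x]valZpK -Zp_nat -(pFrobenius_autE pc) pFrobenius_aut_nat.
Qed.

Lemma Zp_mulrn_eq0 D n : D != 0 -> (0 < n < p)%N -> D *+ n != 0.
Proof.
move=> D0 /andP[n0 np]; rewrite -mulr_natl Zp_mulf_neq0 // Zp_nat.
by apply/eqP => /(congr1 val) /=; rewrite modn_small // => /eqP; rewrite -leqn0 leqNgt n0.
Qed.

Lemma Zp_multiple D m : D != 0 -> m != 0 -> exists2 n, m = D *+ n.+1 & (n.+1 < p)%N.
Proof.
move=> D0 m0; have Du := Zp_unit D0.
have E : m = D *+ (D^-1 * m)%R by rewrite -mulr_natr Zp_nat valZpK mulrA divrr // mul1r.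
have := ltn_ord (D^-1 * m); case: (nat_of_ord _) E => [|n] E ltn; last by exists n.
by rewrite E eqxx in m0.
Qed.

(* If the first two cases fail, then f (j D) = l ^ (j - 1) f(D) for 0 < j < p.  For
   p > 3, the failure of the first case at 2 D gives l ^ p = 1, so l = 1 and f is
   constant. *)
Lemma exponent_cases f : odd p -> (exists x y, [/\ x != 0, y != 0 & f x != f y]) ->
  f 0 = 0 ->
  [\/ exists D m, [/\ f D != 0, m != 0, m != D & f m * f D != f (m - D) * f (D + D)],
      exists D, [/\ f D != 0 & f (- D) = 0] |
      exists D, [/\ f D != 0, D + D = - D, f (- D) = - f D & f D + f D = - f D] ].
Proof.
move=> p_odd [x0 [y0 [x0N0 y0N0 f_nc]]] f0.
(* Assuming that no case holds, the third is derived from the failure of the first two: by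
   contradiction for p > 3, directly for p = 3. *)
apply: contrapT => none; apply: (none); constructor 3.
have H1 : ~ exists D m, [/\ f D != 0, m != 0, m != D & f m * f D != f (m - D) * f (D + D)].
  by move=> ?; apply: none; constructor 1.
have H2 : ~ exists D, [/\ f D != 0 & f (- D) = 0].
  by move=> ?; apply: none; constructor 2.
have {}H1 D m : f D != 0 -> m != 0 -> m != D -> f m * f D = f (m - D) * f (D + D).
  by move=> fD m0 mD; apply: contra_notP H1 => /eqP ?; exists D, m.
have {}H2 D : f D != 0 -> f (- D) != 0.
  by move=> fD; apply: contra_notN H2 => /eqP ?; exists D.
have [D fD] : exists D, f D != 0.
  have [x00|] := eqVneq (f x0) 0; last by exists x0.
  by exists y0; rewrite -x00 eq_sym.
have DN0 : D != 0 by apply: contraNneq fD => ->; rewrite f0.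
have DDN0 : D + D != 0.
  by rewrite -mulr2n Zp_mulrn_eq0 //=; case: (q) p_odd.
have DND : D != D + D by rewrite -subr_eq0 opprD addNKr oppr_eq0.
have fDD : f (D + D) != 0.
  have NDD : - D != D by rewrite eq_sym -addr_eq0.
  (* This instance reads f(-D) f(D) = f(-2D) f(2D). *)
  apply/eqP => E; have := H1 D (- D) fD; rewrite oppr_eq0 E mulr0 => /(_ DN0 NDD) /eqP.
  by apply/negP/Zp_mulf_neq0 => //; apply: H2.
pose l := f (D + D) / f D.
have lE : f (D + D) = l * f D by rewrite mulrVK // Zp_unit.
have lN0 : l != 0 by apply: contraNneq fDD => l0; rewrite lE l0 mul0r.
have geo n : (n.+1 < p)%N -> f (D *+ n.+1) = l ^+ n * f D.
  elim: n => [|n IH] np; first by rewrite mul1r.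
  apply: (Zp_mulIf fD); rewrite H1 ?Zp_mulrn_eq0 //; last first.
    by rewrite mulrSr -subr_eq0 addrK Zp_mulrn_eq0 //= ltnW.
  by rewrite mulrSr addrK IH ?(ltnW np) // lE exprS mulrCA !mulrA.
have lN1 : l != 1.
  apply: contraNneq f_nc => l1.
  have [n1 -> n1p] := Zp_multiple DN0 x0N0; have [n2 -> n2p] := Zp_multiple DN0 y0N0.
  by rewrite !geo // l1 !expr1n.
have [q3|q3] := leqP 3 q.
  have fND : f (- D) = l ^+ q * f D.
    rewrite -geo //; congr f; apply/eqP; rewrite eq_sym -addr_eq0 -mulrSr.
    by rewrite Zp_mulrp.
  have f4 : f (D + D + (D + D)) = l ^+ 3 * f D.
    by rewrite -geo //; congr f; rewrite !mulrSr mulr0n add0r !addrA.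
  (* It reads f(D) f(2D) = f(-D) f(4D). With -D = (p - 1) D, and 4 < p, the geometric law turns it
     into l = l ^ (p + 1). *)
  have := H1 (D + D) D fDD DN0 DND.
  rewrite opprD addNKr f4 fND lE => E.
  have {}E : l * (f D * f D) = l ^+ p * l * (f D * f D).
    transitivity (f D * (l * f D)); first by rewrite mulrCA.
    rewrite E [l ^+ p * l]mulrC -exprS mulrACA -exprD addn3; by [].
  have := Zp_mulIf (Zp_mulf_neq0 fD fD) E.
  rewrite -{1}[l]mul1r => /(Zp_mulIf lN0); rewrite Zp_fermat => l1.
  by rewrite -l1 eqxx in lN1.
have q1 : q = 1%N by move: q3 p_odd; case: (q) => [|[|[|]]].
have D3 x : x + x = - x.
  have E : x *+ 3 = 0 by rewrite -(Zp_mulrp x); congr (x *+ _); rewrite q1.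
  by apply/eqP; rewrite -addr_eq0 -E !mulrSr mulr0n add0r.
exists D; split=> //.
rewrite -D3 lE.
(* For p = 3 the only value of l other than 0 and 1 is -1. *)
have : l ^+ 3 = l by rewrite -[RHS]Zp_fermat; congr (l ^+ _); rewrite q1.
rewrite exprSr -[RHS]mul1r => /(Zp_mulIf lN0) /eqP.
rewrite -subr_eq0 -[X in _ - X](expr1n _ 2) subr_sqr => /eqP E.
have /eqP : l + 1 = 0.
  have : l - 1 != 0 by rewrite subr_eq0.
  by move=> lN; apply: (Zp_mulIf lN); rewrite mul0r mulrC.
by rewrite addr_eq0 => /eqP ->; rewrite mulN1r.
Qed.

End ZpArith.

(** * Branching: gamma_3(G)@0 lies in gamma_4(G) *)

Section Branch.
Variable q : nat.
Local Notation p := q.+2.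
Variable e : 'rV['F_p]_p.-1.
Hypothesis p_prime : prime p.
Local Notation aut := (tree_aut p).
Local Notation a := (@ggs_a p).
Local Notation b := (@ggs_b p e).
Local Notation G := (ggs_group e).
Local Notation G2 := (comm_sub G G).
Local Notation G3 := (comm_sub G2 G).
Local Notation G4 := (comm_sub G3 G).
Local Notation eps := (ggs_eps e).
Local Notation be := (ggs_be e).
Local Notation bb := (ggs_bb e).
Implicit Types (h : 'I_p -> aut) (f g k : aut) (u v w : seq 'I_p) (i j m x y D : 'I_p).

Let aP : a ^+ p = 1 := ggs_a_exp p.
Let sG : is_subgroup G := ggs_subgroup e.

Lemma expg_Zp_inv (T : groupType) (z : T) (r : 'I_p) : z ^+ p = 1 -> r != 0%R ->
  exists n, z ^+ r ^+ n = z.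
Proof.
move=> zp /(Zp_unit p_prime) ru; exists (r^-1)%R.
by rewrite -expg_ZpM // divrr // expg_Zp1.
Qed.

(** Sections of conjugates of b provide [a ^+ eps D] rather than a, so this is the generating pair
    used below. *)
Lemma ggs_group_gen (r : 'I_p) : r != 0%R -> G = generated [set a ^+ r; b].
Proof.
move=> r0; have [n En] := expg_Zp_inv aP r0.
apply/seteqP; split; apply: generated_sub; try exact: generated_subgroup.
- move=> _ [->|->]; last by apply: mem_generated; right.
  have := is_subgroupX n (generated_subgroup [set a ^+ r; b]) (mem_generated (or_introl erefl)).
  by rewrite En.
- by move=> _ [->|->]; [apply: ggs_group_aX | apply: ggs_group_b].
Qed.

Lemma eps0 : eps 0%R = 0%R. Proof. by rewrite /ggs_eps eqxx. Qed.

Lemma spread_section_mem h x : G (spread h) -> G (h x).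
Proof.
move=> Gh; have [i [l E]] := ggs_groupP Gh.
have i0 : i = 0%R.
  have := congr1 (fun f : aut => f [:: x]) E.
  rewrite bbs_spread autE !spreadE ggs_aXE => -[/eqP].
  by rewrite -subr_eq0 opprD addNKr oppr_eq0 => /eqP.
rewrite i0 [a ^+ _]expg0 mul1g bbs_spread in E; rewrite (spread_inj E x).
elim/big_ind: _; [exact: (is_subgroup1 sG) | | by move=> *; apply: ggs_group_be].
by move=> ? ?; apply: (is_subgroupM sG).
Qed.

(** Conjugates of b differ by an element of gamma_2(G), and only this factor contributes to the
    commutator. *)
Lemma bb_comm_G3 i j : G3 [~ bb i, bb j].
Proof.
have Gi : G (bb i) by apply: ggs_group_bb.
have Ga : G (a ^+ (i - j)%R) by apply: ggs_group_aX.
have -> : bb j = bb i * [~ bb i, a ^+ (i - j)%R].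
  by rewrite commgEl mulVKg bb_aJ opprB addrC subrK.
rewrite commgMr commgg conj1g mulg1 -invgR; apply: (is_subgroupV (comm_sub_subgroup _ _)).
exact: mem_comm_sub (mem_comm_sub Gi Ga) Gi.
Qed.

Section Projection.
Variable D : 'I_p.
Hypothesis epsD : eps D != 0%R.

Let D0 : D != 0%R.
Proof. by apply: contraNneq epsD => ->; rewrite eps0. Qed.

(** G is fractal: at [x] the conjugate [bb (x - D)] has section [a ^+ eps D] and [bb x] has section
    b, and these generate G. *)
Lemma ggs_section x g : G g -> exists h, G (spread h) /\ h x = g.
Proof.
rewrite {1}(ggs_group_gen epsD); move: g; apply: generated_sub.
  exact: section_subgroup.
move=> _ [->|->].
- exists (fun y => be (y - (x - D))%R); split; first exact: ggs_group_bb.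
  by rewrite opprB addrC subrK ggs_beN.
- exists (fun y => be (y - x)%R); split; first exact: ggs_group_bb.
  by rewrite subrr /ggs_be eqxx.
Qed.

(** By [ggs_section], conjugating [k] by an element of G is induced by conjugating [graft x k] by an
    element of S. *)
Lemma graft_normal N x : is_normal G N -> is_normal G [set k | G k /\ N (graft x k)].
Proof.
move=> /is_normalE[sN NG nN]; apply/is_normalE; split.
- apply: is_subgroup_ind => /= [|k k' [Gk Nk] [Gk' Nk']|k [Gk Nk]].
  + by split; rewrite ?graft1; [apply: (is_subgroup1 sG) | apply: (is_subgroup1 sN)].
  + by split; rewrite -?graftM; [apply: (is_subgroupM sG) | apply: (is_subgroupM sN)].
  + by split; rewrite -?graftV; [apply: (is_subgroupV sG) | apply: (is_subgroupV sN)].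
- by move=> k [].
- move=> g k Gg [Gk Nk]; split; first exact: (is_subgroupJ sG).
  have [h [Gh <-]] := ggs_section x Gg.
  by rewrite -graft_spreadJ; apply: nN.
Qed.

(** The branching at the letter 0 is the inclusion of [G3] in [M]; a carries it to the other
    letters. *)
Let M := [set k | G k /\ G4 (graft 0%R k)].
Let nM : is_normal G M. Proof. exact/graft_normal/G4_normal. Qed.

Lemma graft_comm_mem (N : set aut) k : is_normal G N -> N (graft 0%R k) ->
  forall g, G g -> comm_sub N G (graft 0%R [~ k, g]).
Proof.
move=> nN Nk g Gg; have [h [Gh <-]] := ggs_section 0%R Gg.
by rewrite -graft_spreadR; apply: mem_comm_sub.
Qed.

(** A further commutator with an element of S of prescribed section at 0 raises both classes by
    one. *)
Lemma graft_G3_of_G2 : (forall k, G2 k -> G3 (graft 0%R k)) -> G3 `<=` M.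
Proof.
move=> H; apply: comm_sub_le; first by case/is_normalE: nM.
move=> x y G2x Gy; split; last exact: (graft_comm_mem (G3_normal e) (H _ G2x) Gy).
by apply: (is_subgroupR sG) => //; case/is_normalE: (G2_normal e) => _ + _; apply.
Qed.

(** As G is generated by [a ^+ eps D] and b, gamma_2(G) is the normal closure of their commutator.
    The conjugation by [a ^+ n] accommodates the form produced in [graft_G2_three]. *)
Lemma graft_G2 n : G3 (graft 0%R ([~ b, a ^+ eps D] ^ (a ^+ n))) ->
  forall k, G2 k -> G3 (graft 0%R k).
Proof.
set c := [~ b, _] => H.
have nK := graft_normal 0%R (G3_normal e).
have [sK _ JK] := (is_normalE _ _).1 nK.
have Gc : G c.
  by apply: (is_subgroupR sG); [apply: ggs_group_b | apply: ggs_group_aX].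
have Kc : [set k | G k /\ G3 (graft 0%R k)] c.
  rewrite -(conjgK (a ^+ n) c); apply: JK.
    by apply: (is_subgroupV sG); apply: ggs_group_aX.
  by split=> //; apply: (is_subgroupJ sG) => //; apply: ggs_group_aX.
suff: G2 `<=` [set k | G k /\ G3 (graft 0%R k)] by move=> S k /S[].
apply: (comm_sub2_le sG nK (ggs_group_gen epsD)).
move=> _ _ [->|->] [->|->]; rewrite ?commgg; try exact: (is_subgroup1 sK); last by [].
by rewrite -invgR; apply: (is_subgroupV sK).
Qed.

(** At the other letters both sections are powers of a, which commute. *)
Lemma bb_comm_spread : [~ bb 0%R, bb (- D)%R] =
  spread (fun y => if y == 0%R then [~ b, a ^+ eps D]
                   else if y == (- D)%R then [~ be (- D)%R, b] else 1).
Proof.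
rewrite spreadR; apply: spread_ext => y; rewrite subr0 opprK.
have [->|y0] := eqVneq; first by rewrite add0r (ggs_beN _ D0) /ggs_be eqxx.
have [->|yD] := eqVneq; first by rewrite addNr {2}/ggs_be eqxx.
rewrite !ggs_beN // -?addr_eq0 //; last by rewrite addr_eq0.
by apply/eqP/commgP; apply: commuteX2.
Qed.

(** A section trivial at -D cuts the second letter off the commutator of [bb 0] and [bb (- D)],
    which lies in gamma_3(G). *)
Lemma graft_comm2 h : G (spread h) -> h (- D)%R = 1 ->
  M [~ [~ b, a ^+ eps D], h 0%R].
Proof.
move=> Gh hD.
have E : graft 0%R [~ [~ b, a ^+ eps D], h 0%R] = [~ [~ bb 0%R, bb (- D)%R], spread h].
  rewrite bb_comm_spread spreadR; apply: spread_ext => y.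
  have [->|y0] := eqVneq; first by [].
  by have [->|yD] := eqVneq; rewrite ?hD ?commg1 ?comm1g.
split; last first.
  by rewrite E; apply: mem_comm_sub => //; apply: bb_comm_G3.
apply: (is_subgroupR sG).
  by apply: (is_subgroupR sG); [apply: ggs_group_b | apply: ggs_group_aX].
exact: spread_section_mem.
Qed.

Lemma bb_mul_section i j n h : spread h = bb i * bb j ^+ n ->
  G (spread h) /\ forall x, h x = be (x - i)%R * be (x - j)%R ^+ n.
Proof.
move=> E; split.
  rewrite E; apply: (is_subgroupM sG); first exact: ggs_group_bb.
  by apply: (is_subgroupX n sG); apply: ggs_group_bb.
by move=> x; move: E; rewrite spreadX spreadM => /spread_inj/(_ x).
Qed.

(** At -D the conjugate [bb (- (D + D))] has section [a ^+ eps D], with invertible exponent, so its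
    powers can cancel any power of a there. *)
Lemma graft_comm2_bb i (s : 'I_p) : be (- D - i)%R * be D ^+ s = 1 ->
  M [~ [~ b, a ^+ eps D], be (- i)%R * be (D + D)%R ^+ s].
Proof.
move=> E; pose h x := be (x - i)%R * be (x - (- (D + D)))%R ^+ s.
have [|Gh _] := @bb_mul_section i (- (D + D))%R s h; first by rewrite spreadX spreadM.
have := graft_comm2 Gh; rewrite /h sub0r !opprK add0r addKr.
by apply.
Qed.

(* The exponents [s] make the section of [bb (- m) * bb (- 2 D) ^+ s], then of
   [bb 0 * bb (- 2 D) ^+ s], trivial at [- D]. *)
Lemma graft_G3_generic m : (D + D != 0)%R -> m != 0%R -> m != D ->
  (eps m * eps D != eps (m - D) * eps (D + D))%R -> G3 `<=` M.
Proof.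
move=> DD m0 mD neq; have [sM _ JM] := (is_normalE _ _).1 nM.
have Du := Zp_unit p_prime epsD; set c := [~ b, a ^+ eps D].
have Gc : G c.
  by apply: (is_subgroupR sG); [apply: ggs_group_b | apply: ggs_group_aX].
have sC := comm_mem_r sG nM Gc.
set C := [set y | G y /\ M [~ c, y]] in sC.
have Ca : C a.
  pose s := (- (eps (m - D) / eps D))%R.
  have := @graft_comm2_bb (- m)%R s; rewrite !opprK addrC.
  rewrite !ggs_beN ?subr_eq0 // -!expg_ZpM // -!expg_ZpD // mulrN mulrCA divrr // mulr1.
  rewrite subrr expg0 => /(_ erefl); set t := (eps m + _)%R => Mt.
  (* [t * eps D] is the difference of the two sides of the assumed inequality. *)
  have t0 : t != 0%R.
    apply: contraNneq neq => t0; apply/eqP; apply/eqP.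
    rewrite -subr_eq0 -(mul0r (eps D)) -t0 mulrDl; apply/eqP; congr (_ + _)%R.
    by rewrite /s mulrN mulNr mulrA mulrVK // mulrC.
  have [n <-] := expg_Zp_inv aP t0.
  by apply: (is_subgroupX n sC); split=> //; apply: ggs_group_aX.
have Cb : C b.
  pose s := (- (eps (- D) / eps D))%R.
  have := @graft_comm2_bb 0%R s; rewrite subr0 oppr0.
  rewrite (ggs_beN _ DD) (ggs_beN _ D0) ggs_beN ?oppr_eq0 //.
  rewrite -!expg_ZpM // -!expg_ZpD // {1}/s mulrN mulrCA divrr // mulr1 subrr expg0.
  rewrite {1}/ggs_be eqxx => /(_ erefl) Mt.
  set t := (_ * s)%R in Mt.
  (* The section found at 0 is [b * a ^+ t]; as a is already in [C], the power can be stripped. *)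
  have Ct : C (a ^+ t) := is_subgroupX t sC Ca.
  rewrite -(mulgK (a ^+ t) b); apply: sC.2 => //; split=> //.
  by apply: (is_subgroupM sG); [apply: ggs_group_b | apply: ggs_group_aX].
have Cc z : [set a ^+ eps D; b] z -> M [~ c, z].
  by move=> [->|->]; [case: (is_subgroupX (eps D) sC Ca) | case: Cb].
apply: (comm_sub3_le sG nM (ggs_group_gen epsD)).
move=> _ _ z [->|->] [->|->] Az; rewrite ?commgg ?comm1g; try exact: (is_subgroup1 sM).
  rewrite -[X in [~ X, z]]invgR commgVl; apply: JM.
    exact: (is_subgroupV sG).
  by apply: (is_subgroupV sM); apply: Cc.
exact: Cc.
Qed.

(** The section of [bb 0] at -D is trivial, so its commutator with [bb (- D)] is already a graft at
    0. *)
Lemma graft_G2_zero : eps (- D)%R = 0%R -> forall k, G2 k -> G3 (graft 0%R k).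
Proof.
move=> epsND; apply: (@graft_G2 0); rewrite expg0 conjg1.
have -> : graft 0%R [~ b, a ^+ eps D] = [~ bb 0%R, bb (- D)%R].
  rewrite bb_comm_spread; apply: spread_ext => y; case: eqP => // _.
  by case: eqP => // _; rewrite ggs_beN ?oppr_eq0 // epsND expg0 comm1g.
exact: bb_comm_G3.
Qed.

Lemma graft_G2_three : (D + D = - D)%R -> (eps (- D) = - eps D)%R ->
  (eps D + eps D = - eps D)%R -> forall k, G2 k -> G3 (graft 0%R k).
Proof.
move=> DD epsND eps2; apply: (@graft_G2 (eps D)).
set al := a ^+ eps D.
have al2 : al * al = al^-1 by rewrite -expg_ZpD // eps2 expg_ZpV.
have beD : be D = al by rewrite ggs_beN.
have beND : be (- D)%R = al^-1 by rewrite ggs_beN ?oppr_eq0 // epsND expg_ZpV.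
have cV : [~ al^-1, al] = 1 by rewrite -invgR commgVg invg1.
have E1 : [~ b, al^-1] ^ al = [~ al, b].
  by rewrite !commgEl !conjgE !(invgM, invgK, mulgA, mulgK, mulgVK).
have be0 : be 0%R = b by rewrite /ggs_be eqxx.
have DND : (D == - D)%R = false.
  by apply/negP; rewrite -DD -subr_eq0 opprD addNKr oppr_eq0 (negPf D0).
have NDD : (- D - D)%R = D by rewrite -opprD DD opprK.
(* The three pairs of conjugates at 0, D, -D are combined cyclically: by [E1] the sections at D and
   -D cancel, and [al2] brings the one at 0 to the stated form. *)
have -> : graft 0%R ([~ b, al] ^ al) = [~ bb (- D)%R, bb 0%R] * [~ bb 0%R, bb D]
    / [~ bb D, bb (- D)%R] ^ bb 0%R.
  rewrite !spreadR spreadJ spreadV !spreadM; apply: spread_ext => y.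
  have [->|y0] := eqVneq.
    rewrite subr0 !sub0r !opprK be0 beD beND cV.
    rewrite conj1g divg1 !commgEl !conjgE !(invgM, invgK, mulgA, mulgK, mulgVK).
    by rewrite -!(mulgA _ al al) al2.
  have [->|yD] := eqVneq y D.
    rewrite subr0 opprK subrr DD be0 beD beND.
    by rewrite cV mul1g E1 mulgV.
  have [->|yND] := eqVneq y (- D)%R.
    rewrite subr0 opprK addNr NDD be0 beD beND.
    by rewrite cV mulg1 -E1 conjgK mulgV.
  rewrite !ggs_beN ?subr_eq0 //.
  have cX n n' : [~ a ^+ n, a ^+ n'] = 1.
    by apply/eqP/commgP; apply: commuteX2.
  by rewrite !cX conj1g invg1 !mulg1.
have [s3 _ J3] := (is_normalE _ _).1 (G3_normal e).
apply: s3.2; first by apply: (is_subgroupM s3); apply: bb_comm_G3.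
by apply: J3; [apply: ggs_group_bb | apply: bb_comm_G3].
Qed.

End Projection.
End Branch.

(** * Finite differences and convolution modulo p *)

Section FiniteDifferences.
Variable q : nat.
Local Notation p := q.+2.
Hypothesis p_prime : prime p.
Local Open Scope ring_scope.
Implicit Types (x y : 'I_p) (f : 'I_p -> 'I_p) (l : seq 'I_p).

Definition fdiff f x := f (x + 1) - f x.

Lemma newton_forward n f x :
  f (x + n%:R) = \sum_(k < n.+1) (iter k fdiff f x) *+ 'C(n, k).
Proof.
elim: n f x => [|n IH] f x; first by rewrite big_ord1 addr0.
have -> : f (x + n.+1%:R) = fdiff f (x + n%:R) + f (x + n%:R).
  by rewrite /fdiff subrK -natr1 addrA.
have E : \sum_(k < n.+1) iter k fdiff f x *+ 'C(n, k)
    = f x + \sum_(k < n.+1) iter k.+1 fdiff f x *+ 'C(n, k.+1).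
  transitivity (\sum_(k < n.+2) iter k fdiff f x *+ 'C(n, k)).
    by rewrite [RHS]big_ord_recr /= bin_small // mulr0n addr0.
  by rewrite big_ord_recl bin0.
rewrite !IH E [RHS]big_ord_recl bin0 addrCA; congr (_ + _).
rewrite addrC -big_split; apply: eq_bigr => k _.
by rewrite -iterSr /= binS mulrnDr.
Qed.

(** In the Newton formula at n = p the left side is f(x), and the inner binomials are divisible by
    p. *)
Lemma iter_fdiff_p f x : iter p fdiff f x = 0.
Proof.
have := newton_forward p f x.
rewrite Zp_p_eq0 addr0 big_ord_recl bin0 mulr1n big_ord_recr /= binn mulr1n.
rewrite big1 ?add0r => [|k _]; last first.
  have /dvdnP[m ->] : (p %| 'C(p, bump 0 k))%N.
    by apply: prime_dvd_bin; rewrite // /bump /= add1n /= ltnS ltn_ord.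
  by rewrite mulnC mulrnA Zp_mulrp mul0rn.
by move/eqP; rewrite -{1}[f x]addr0 (inj_eq (addrI _)) eq_sym => /eqP.
Qed.

Lemma fdiff_eq0_const f : (forall x, fdiff f x = 0) -> forall x, f x = f 0.
Proof.
move=> f0 x; rewrite -[x]valZpK -Zp_nat; elim: (\val x) => //= n IH.
by rewrite -IH -natr1; apply/eqP; rewrite -subr_eq0; apply/eqP/f0.
Qed.

(* A non-constant function has an iterated difference that is affine and
   non-constant, because differencing is nilpotent in characteristic p. *)
Lemma convolution_eq0 f l : (exists x y, f x != f y) ->
  (forall x, \sum_(k <- l) f (x - k) = 0) ->
  (size l)%:R = 0 :> 'I_p /\ \sum_(k <- l) k = 0.
Proof.
move=> [x0 [y0 f_nc]] fl.
have ex0 : exists n, [forall x, iter n fdiff f x == 0].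
  by exists p; apply/forallP => x; rewrite iter_fdiff_p.
case: (ex_minnP ex0) => n /forallP n0 n_min.
case: n n0 n_min => [|[|n]] n0 n_min.
- have f0 x : f x = 0 by apply/eqP/n0.
  by rewrite !f0 eqxx in f_nc.
- have fc : forall x, f x = f 0 by apply: fdiff_eq0_const => x; apply/eqP/n0.
  by rewrite (fc x0) (fc y0) eqxx in f_nc.
(* The minimal vanishing order is now [n.+2], so [h] has a constant non-zero difference. It inherits
   the convolution identity because differencing commutes with translations. *)
pose h := iter n fdiff f.
have hl x : \sum_(k <- l) h (x - k) = 0.
  rewrite /h; elim: (n) x => //= m IH x.
  rewrite /fdiff sumrB IH subr0 -[RHS](IH (x + 1)).
  by apply: eq_bigr => k _; rewrite addrAC.
pose c := fdiff h 0.
have dh x : fdiff h x = c by apply: fdiff_eq0_const => y; apply/eqP/n0.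
have c0 : c != 0.
  apply/negP => /eqP c0; have := n_min n.+1; rewrite ltnn => H; suff: false by [].
  by apply: H; apply/forallP => x; rewrite /= -/h dh c0.
have hE x : h x = h 0 + c * x.
  have := @fdiff_eq0_const (fun x => h x - c * x) _ x; rewrite mulr0 subr0 => <-.
    by rewrite subrK.
  move=> y; have E : h (y + 1) = h y + c by apply/eqP; rewrite [_ + c]addrC -subr_eq -(dh y).
  by rewrite /fdiff E mulrDr mulr1 [(_ * y + _)%R]addrC addrKA subrr.
have sumc (z : 'I_p) : \sum_(k <- l) z = z *+ size l.
  by rewrite big_const_seq count_predT iter_addr_0.
have sl : (size l)%:R = 0 :> 'I_p.
  apply: (Zp_mulIf p_prime c0); rewrite mul0r.
  (* The slope [c] is summed once per entry of [l]; evaluation at 0 alone then gives the sum of the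
     entries. *)
  transitivity (\sum_(k <- l) h (1 - k) - \sum_(k <- l) h (0 - k)).
    rewrite -sumrB mulr_natl -sumc; apply: eq_bigr => k _.
    by rewrite (hE (1 - k)) (hE (0 - k)) opprD addrACA subrr add0r -mulrBr
      opprD addrACA subrr addr0 subr0 mulr1.
  by rewrite !hl subrr.
split=> //.
have := hl 0; under eq_bigr do rewrite hE sub0r.
rewrite big_split /= -mulr_sumr sumrN sumc -mulr_natl sl mul0r add0r mulrN.
by move/eqP; rewrite oppr_eq0 => /eqP E; apply: (Zp_mulIf p_prime c0); rewrite mul0r mulrC.
Qed.

End FiniteDifferences.

(** * Level stabilizers inside the lower central series *)

Section LevelStab.
Variable q : nat.
Local Notation p := q.+2.
Variable e : 'rV['F_p]_p.-1.
Hypotheses (p_prime : prime p) (p_odd : odd p).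
Local Notation aut := (tree_aut p).
Local Notation a := (@ggs_a p).
Local Notation b := (@ggs_b p e).
Local Notation G := (ggs_group e).
Local Notation G2 := (comm_sub G G).
Local Notation G3 := (comm_sub G2 G).
Local Notation G4 := (comm_sub G3 G).
Local Notation eps := (ggs_eps e).
Local Notation be := (ggs_be e).
Local Notation bb := (ggs_bb e).
Local Notation bbs := (ggs_bbs e).
Implicit Types (h : 'I_p -> aut) (f g k : aut) (u v w : seq 'I_p) (i j m x y D : 'I_p)
  (l : seq 'I_p).
Hypothesis eps_nc : exists x y, [/\ x != 0%R, y != 0%R & eps x != eps y].

Let aP : a ^+ p = 1 := ggs_a_exp p.
Let sG : is_subgroup G := ggs_subgroup e.
Let nG2 : is_normal G G2 := G2_normal e.
Let nG3 : is_normal G G3 := G3_normal e.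
Let nG4 : is_normal G G4 := G4_normal e.

Lemma eps_neq0 : exists D, eps D != 0%R.
Proof.
have [x [y [_ _ xy]]] := eps_nc.
have [x0|] := eqVneq (eps x) 0%R; last by exists x.
by exists y; rewrite -x0 eq_sym.
Qed.

Lemma graft_G3 x k : G3 k -> G4 (graft x k).
Proof.
suff H : G3 `<=` [set k | G k /\ G4 (graft 0%R k)].
  move=> /H[_ G4k]; have -> : graft x k = graft 0%R k ^ (a ^+ (- x)%R).
    by rewrite graft_aJ sub0r opprK.
  by have [_ _] := (is_normalE _ _).1 nG4; apply=> //; apply: ggs_group_aX.
have DD D : eps D != 0%R -> (D + D)%R != 0%R.
  move=> epsD; rewrite -mulr2n Zp_mulrn_eq0 //=; last by case: (q) p_odd.
  by apply: contraNneq epsD => ->; rewrite eps0.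
have [] := exponent_cases p_prime p_odd eps_nc (eps0 e).
- move=> [D [m [epsD m0 mD neq]]].
  by apply: (graft_G3_generic p_prime epsD _ m0 mD neq); apply: DD.
- move=> [D [epsD epsND]].
  by apply: (graft_G3_of_G2 p_prime epsD); apply: (graft_G2_zero p_prime epsD).
- move=> [D [epsD D1 D2 D3]].
  by apply: (graft_G3_of_G2 p_prime epsD); apply: (graft_G2_three p_prime epsD).
Qed.

Lemma G4_sub_G3 : G4 `<=` G3. Proof. exact: comm_sub_normal_sub. Qed.
Lemma G3_sub_G : G3 `<=` G. Proof. by case/is_normalE: nG3. Qed.

Lemma graftw_G3 u k : G3 k -> G3 (graftw u k).
Proof. by move=> G3k; elim: u => //= x u IH; apply: G4_sub_G3; apply: graft_G3. Qed.

Lemma level_stab_subgroup n : is_subgroup (@level_stab p n).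
Proof.
apply: is_subgroup_ind => /= [w _|g g' gn gn' w wn|g gn w wn]; first by [].
- by rewrite autE gn' // gn.
- exact/aut_fixV/gn.
Qed.

Lemma level_stab_normal n : is_normal G (G `&` level_stab n).
Proof.
have sL := level_stab_subgroup n; apply/is_normalE; split.
- split=> [|x y [Gx Lx] [Gy Ly]]; first by
    split; [apply: (is_subgroup1 sG) | apply: (is_subgroup1 sL)].
  by split; [apply: sG.2 | apply: sL.2].
- by move=> x [].
- move=> g x Gg [Gx Lx]; split; first exact: (is_subgroupJ sG).
  by move=> w wn; rewrite conjgE !autE Lx ?size_aut // aut_KV.
Qed.

(** As b fixes the first level, G / S is generated by the image of a, hence abelian. *)
Lemma G2_level_stab1 : G2 `<=` G `&` level_stab 1.
Proof.
have nL := level_stab_normal 1; have [sL _ JL] := (is_normalE _ _).1 nL.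
have Lb : (G `&` level_stab 1) b by split; [apply: ggs_group_b | apply: ggs_b_st1].
have Lab : (G `&` level_stab 1) [~ a, b].
  rewrite commgEr; apply: (is_subgroupM sL) => //; apply: JL; first exact: ggs_group_a.
  exact: (is_subgroupV sL).
apply: (comm_sub2_le sG nL (erefl : G = generated _)).
move=> _ _ [->|->] [->|->]; rewrite ?commgg; try exact: (is_subgroup1 sL); first by [].
by rewrite -invgR; apply: (is_subgroupV sL).
Qed.

Lemma ggs_group_st1 g : G g -> level_stab 1 g -> exists l, g = bbs l.
Proof.
move=> Gg g1; have [i [l E]] := ggs_groupP Gg; exists l.
have := g1 [:: i] erefl; rewrite E autE bbs_spread spreadE ggs_aXE => -[/eqP].
by rewrite -subr_eq0 addrK => /eqP ->; rewrite [a ^+ _]expg0 mul1g.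
Qed.

(** Modulo gamma_2(G) the factors can be sorted: entries equal to [x] give b and are counted by [n].
    The value [eps 0 = 0] lets the sum run over the whole list. *)
Lemma bbs_section_mod_G2 l x : exists n,
  eqm G2 (\prod_(i <- l) be (x - i)%R) (a ^+ (\sum_(i <- l) eps (x - i))%R * b ^+ n).
Proof.
have sG2 := comm_sub_subgroup G G.
elim: l => [|i l [n IH]].
  by exists 0; rewrite !big_nil mulg1; apply: (eqm_refl nG2).
have Gab : G (a ^+ (\sum_(i <- l) eps (x - i))%R * b ^+ n).
  apply: (is_subgroupM sG); first exact: ggs_group_aX.
  by apply: (is_subgroupX n sG); apply: ggs_group_b.
have GP : G (\prod_(i <- l) be (x - i)%R).
  elim/big_ind: _; [exact: (is_subgroup1 sG) | | by move=> *; apply: ggs_group_be].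
  by move=> ? ?; apply: (is_subgroupM sG).
rewrite !big_cons; have [E|N0] := eqVneq (x - i)%R 0%R; last first.
  exists n; rewrite expg_ZpD // -mulgA ggs_beN //.
  by apply: (eqmM nG2) => //; apply: (eqm_refl nG2).
exists n.+1; rewrite E eps0 add0r expgS /ggs_be eqxx.
apply: (eqm_trans nG2 (eqmM nG2 GP (eqm_refl nG2 b) IH)).
rewrite !mulgA; apply: (eqmM nG2); last 1 first.
- exact: (eqm_refl nG2).
- by apply: (is_subgroupX n sG); apply: ggs_group_b.
have := mem_comm_sub (@ggs_group_aX q e (\sum_(j <- l) eps (x - j))%R) (@ggs_group_b q e).
exact: eqm_comm.
Qed.

(** [c] is central modulo gamma_3(G), and [bb i], the conjugate of [bb 0] by the i-th power of a^-1,
    becomes [bb 0 * c ^+ i]. So only the length and the sum of a list survive, the two quantities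
    controlled by [convolution_eq0]. *)
Let c := [~ bb 0%R, a^-1].

Lemma comm_bb_a_mod_G3 n : eqm G3 [~ bb 0%R, a^-1 ^+ n] (c ^+ n).
Proof.
have Gb : G (bb 0%R) by apply: ggs_group_bb.
have Ga' : G a^-1 by apply: (is_subgroupV sG); apply: ggs_group_a.
elim: n => [|n IH]; first by rewrite commg1; apply: (eqm_refl nG3).
have G2n : G2 [~ bb 0%R, a^-1 ^+ n].
  by apply: mem_comm_sub => //; apply: (is_subgroupX n sG).
rewrite expgSr commgMr expgS; apply: (eqmM nG3).
- apply: (is_subgroupJ sG) => //; apply: (is_subgroupR sG) => //.
  exact: (is_subgroupX n sG).
- exact: (eqm_refl nG3).
apply: (eqm_trans nG3 _ IH); apply: (eqm_sym nG3).
by rewrite /eqm -commgEl; apply: mem_comm_sub.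
Qed.

Lemma bb_mod_G3 i : eqm G3 (bb i) (bb 0%R * c ^+ i).
Proof.
have Gb : G (bb 0%R) by apply: ggs_group_bb.
have Ga' : G a^-1 by apply: (is_subgroupV sG); apply: ggs_group_a.
have -> : bb i = bb 0%R * [~ bb 0%R, a^-1 ^+ i].
  by rewrite commgEl mulVKg bbE expg_ZpV // expVgn.
apply: (eqmM nG3); [|exact: (eqm_refl nG3)|exact: comm_bb_a_mod_G3].
by apply: (is_subgroupR sG) => //; apply: (is_subgroupX i sG).
Qed.

Lemma bbs_mod_G3 l :
  eqm G3 (bbs l) (bb 0%R ^+ size l * c ^+ (\sum_(i <- l) (i : nat))).
Proof.
have Gb : G (bb 0%R) by apply: ggs_group_bb.
have Ga' : G a^-1 by apply: (is_subgroupV sG); apply: ggs_group_a.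
have G2c : G2 c by apply: mem_comm_sub.
have Gc : G c by apply: (is_subgroupR sG).
have GX z n : G z -> G (z ^+ n) by apply: (is_subgroupX n sG).
elim: l => [|i l IH].
  by rewrite /ggs_bbs !big_nil mulg1; apply: (eqm_refl nG3).
rewrite bbs_cons big_cons /= expgS expgnDr.
apply: (eqm_trans nG3 (eqmM nG3 (ggs_group_bbs _) (bb_mod_G3 i) IH)).
rewrite !mulgA; apply: (eqmM nG3); [exact: GX| |exact: (eqm_refl nG3)].
rewrite -!mulgA; apply: (eqmM nG3); [|exact: (eqm_refl nG3)|].
  by apply: (is_subgroupM sG); apply: GX.
apply: (eqm_sym nG3); apply: (@eqm_comm _ G3); apply: mem_comm_sub; last exact: GX.
by apply: (is_subgroupX i (comm_sub_subgroup _ _)).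
Qed.

(** The sections lie in st(1), as do b and gamma_2(G), so their total exponents of a vanish; these
    form the convolution of [eps] with [l]. *)
Lemma level_stab2_G3 : G `&` level_stab 2 `<=` G3.
Proof.
move=> g [Gg g2]; have g1 := level_stab_mono (leqnSn 1) g2.
have [l E] := ggs_group_st1 Gg g1; rewrite {}E in Gg g1 g2 *.
have s0 x : (\sum_(i <- l) eps (x - i) = 0)%R.
  have [n En] := bbs_section_mod_G2 l x; set s := (\sum_(i <- l) _)%R in En *.
  have L1 := level_stab_subgroup 1.
  have : level_stab 1 (\prod_(i <- l) be (x - i)%R).
    by move: g2; rewrite bbs_spread => /(@level_stab_spread _ 1 _ x).
  move=> /(is_subgroupM L1)/(_ (G2_level_stab1 En).2); rewrite mulVKg.
  have b1 := is_subgroupX n L1 (ggs_b_st1 e).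
  move=> /(is_subgroupM L1)/(_ (is_subgroupV L1 b1)); rewrite mulgK.
  move=> /(_ [:: s] erefl); rewrite ggs_aXE => -[/eqP].
  by rewrite -subr_eq0 addrK => /eqP.
have [l0 sl0] : ((size l)%:R = 0 :> 'I_p)%R /\ (\sum_(k <- l) k = 0)%R.
  apply: (convolution_eq0 p_prime) s0; have [x [y [_ _ xy]]] := eps_nc.
  by exists x, y.
have dvdp n : (n%:R = 0 :> 'I_p)%R -> n = (n %/ p * p)%N.
  rewrite Zp_nat => /(congr1 val) /= n0; rewrite {1}(divn_eq n p) n0 addn0; by [].
have := eqm_sym nG3 (bbs_mod_G3 l); rewrite /eqm.
have -> : bb 0%R ^+ size l = 1.
  by rewrite (dvdp _ l0) mulnC expgnA bbP expg1n.
have s3 : is_subgroup G3 by case/is_normalE: nG3.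
(* It is congruent to the commutator of [bb 0] with the p-th power of a^-1, which is trivial. *)
have cp : G3 (c ^+ p).
  have := comm_bb_a_mod_G3 p.
  by rewrite expVgn aP invg1 commg1 /eqm invg1 mul1g.
have cs : G3 (c ^+ (\sum_(i <- l) (i : nat))).
  rewrite (dvdp (\sum_(i <- l) (i : nat))); last first.
    by rewrite natr_sum -[RHS]sl0; apply: eq_bigr => i _; rewrite Zp_nat valZpK.
  by rewrite mulnC expgnA; apply: (is_subgroupX _ s3).
by rewrite mul1g => /(is_subgroupM s3 cs); rewrite mulVKg.
Qed.

Lemma level_stab3_G4 : G `&` level_stab 3 `<=` G4.
Proof.
move=> g [Gg g3].
have [l E] := ggs_group_st1 Gg (level_stab_mono (isT : 1 <= 3) g3).
rewrite bbs_spread in E; rewrite E in Gg g3 *.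
apply: (@spread_graft_mem _ G4 [::]); first by case/is_normalE: nG4.
move=> x; apply: graft_G3; apply: level_stab2_G3; split.
  exact: spread_section_mem Gg.
exact: level_stab_spread g3.
Qed.

End LevelStab.

(** * Level stabilizers inside non-trivial normal subgroups *)

Section NormalSubgroups.
Variable q : nat.
Local Notation p := q.+2.
Variable e : 'rV['F_p]_p.-1.
Hypotheses (p_prime : prime p) (p_odd : odd p).
Local Notation aut := (tree_aut p).
Local Notation a := (@ggs_a p).
Local Notation b := (@ggs_b p e).
Local Notation G := (ggs_group e).
Local Notation G2 := (comm_sub G G).
Local Notation G3 := (comm_sub G2 G).
Local Notation G4 := (comm_sub G3 G).
Local Notation eps := (ggs_eps e).
Local Notation be := (ggs_be e).
Local Notation bb := (ggs_bb e).
Local Notation bbs := (ggs_bbs e).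
Implicit Types (h : 'I_p -> aut) (f g k : aut) (u v w : seq 'I_p) (i j m x y D : 'I_p)
  (l : seq 'I_p).
Hypothesis eps_nc : exists x y, [/\ x != 0%R, y != 0%R & eps x != eps y].

Let aP : a ^+ p = 1 := ggs_a_exp p.
Let sG : is_subgroup G := ggs_subgroup e.
Let nG2 : is_normal G G2 := G2_normal e.
Let nG3 : is_normal G G3 := G3_normal e.
Let nG4 : is_normal G G4 := G4_normal e.

Lemma section_ex x g : G g -> exists h, G (spread h) /\ h x = g.
Proof. by move=> Gg; have [D epsD] := eps_neq0 eps_nc; apply: (ggs_section p_prime epsD). Qed.

(** Quotients of two conjugates of b lie in gamma_2(G). Unequal exponents make one such section at 0
    a non-trivial power of a; another is a power of a times b. *)
Lemma G2_section g : G g -> exists h, G2 (spread h) /\ h 0%R = g.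
Proof.
have [x [y [x0 y0 xy]]] := eps_nc.
have s2 : is_subgroup G2 by case/is_normalE: nG2.
set K := [set g | exists h, G2 (spread h) /\ h 0%R = g].
have sK : is_subgroup K by apply: section_subgroup.
have bbG2 i j : G2 ((bb i)^-1 * bb j).
  have -> : bb j = bb i ^ (a ^+ (i - j)%R) by rewrite bb_aJ opprB addrC subrK.
  by rewrite -commgEl; apply: mem_comm_sub; [apply: ggs_group_bb | apply: ggs_group_aX].
have Kbb i j : K ((be (- i)%R)^-1 * be (- j)%R).
  exists (fun z => (be (z - i)%R)^-1 * be (z - j)%R); rewrite !sub0r; split=> //.
  by have := bbG2 i j; rewrite spreadV spreadM.
have Ka : K a.
  have := Kbb (- x)%R (- y)%R; rewrite !opprK !ggs_beN // -expg_ZpV // -expg_ZpD //.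
  set t := (_ + _)%R => Kt.
  have t0 : t != 0%R by rewrite /t addrC subr_eq0 eq_sym.
  by have [n <-] := expg_Zp_inv p_prime aP t0; apply: (is_subgroupX n sK).
have Kb : K b.
  have := Kbb (- x)%R 0%R; rewrite opprK oppr0 ggs_beN // /ggs_be eqxx => Kab.
  rewrite -(mulVKg (a ^+ eps x) b); apply: (is_subgroupM sK) => //.
  exact: (is_subgroupX _ sK).
by move: g; apply: generated_sub => // _ [->|->].
Qed.

Lemma bbs_comm_G3 l l' : G3 [~ bbs l, bbs l'].
Proof.
have Gl t : G (bbs t) by apply: ggs_group_bbs.
have H i t : G3 [~ bb i, bbs t].
  have sC := comm_mem_r sG nG3 (@ggs_group_bb q e i).
  suff [] : [set y | G y /\ G3 [~ bb i, y]] (bbs t) by [].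
  elim: t => [|j t IH]; first by rewrite /ggs_bbs big_nil; apply: (is_subgroup1 sC).
  rewrite bbs_cons; apply: (is_subgroupM sC) => //.
  by split; [apply: ggs_group_bb | apply: bb_comm_G3].
have sC := comm_mem_r sG nG3 (Gl l').
have s3 : is_subgroup G3 by case/is_normalE: nG3.
suff [_ /(is_subgroupV s3)] : [set y | G y /\ G3 [~ bbs l', y]] (bbs l) by rewrite invgR.
elim: l => [|i l IH]; first by rewrite /ggs_bbs big_nil; apply: (is_subgroup1 sC).
rewrite bbs_cons; apply: (is_subgroupM sC) => //.
split; first exact: ggs_group_bb.
by rewrite -invgR; apply: (is_subgroupV s3).
Qed.

(** Since G is fractal, a commutator in G is a section of a commutator of two elements of S, and the
    latter lies in gamma_3(G). *)
Lemma G3_section g : G2 g -> exists h, G3 (spread h) /\ h 0%R = g.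
Proof.
have s3 : is_subgroup G3 by case/is_normalE: nG3.
move: g; apply: comm_sub_le; first exact: section_subgroup.
move=> x y /(section_ex 0%R)[hx [Gx <-]] /(section_ex 0%R)[hy [Gy <-]].
exists (fun z => [~ hx z, hy z]); split=> //; rewrite -spreadR.
have st1 h : level_stab 1 (spread h) by case=> [|z [|]] //= _; rewrite aut_root.
have [l ->] := ggs_group_st1 Gx (st1 _); have [l' ->] := ggs_group_st1 Gy (st1 _).
exact: bbs_comm_G3.
Qed.

Lemma graftw_transport w v : size v = size w ->
  exists g g', [/\ G g, G g' & forall k, graftw w k ^ g = graftw v (k ^ g')].
Proof.
elim: w v => [|x w IH] [|y v] //=.
  by exists 1, 1; split=> [||k]; rewrite ?conjg1 //; apply: (is_subgroup1 sG).
move=> [/IH[g [g' [Gg Gg' E]]]]; have [h [Gh hx]] := section_ex x Gg.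
(* [spread h] moves the tail below [x], and the power of a then moves [x] to [y]. *)
exists (spread h * a ^+ (x - y)%R), g'; split=> // [|k].
  by apply: (is_subgroupM sG) => //; apply: ggs_group_aX.
by rewrite conjgM graft_spreadJ hx E graft_aJ opprB addrC subrK.
Qed.

Section Normal.
Variable N : set aut.
Hypothesis nN : is_normal G N.
Let sN : is_subgroup N. Proof. by case/is_normalE: nN. Qed.
Let NJ : normalized G N. Proof. by case/is_normalE: nN. Qed.

(** Put X = [graftw u K] and Y = [graftw u (spread h')]. As g moves [u], X ^ g commutes with both,
    so [[X, g], Y] = [X^-1, Y]. Two letters follow [u] because sections lead from gamma_3(G) to
    gamma_2(G) and from there to G. *)
Lemma normal_graft_comm g u k k' : N g -> g u <> u -> G3 k -> G k' ->
  N (graftw (u ++ [:: 0%R; 0%R]) [~ k, k']).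
Proof.
move=> Ng gu G3k Gk'; have s3 : is_subgroup G3 by case/is_normalE: nG3.
have [h [G2h h0]] := G2_section Gk'; have [h' [G3h' h'0]] := G3_section G2h.
(* The inverse makes up for X^-1 in [X, g] = X^-1 X^g. *)
pose K := graft 0%R (graft 0%R k^-1).
have G3K : G3 K by apply: (@graftw_G3 _ _ p_prime p_odd eps_nc [:: 0%R; 0%R]);
  apply: (is_subgroupV s3).
have GX : G (graftw u K) by apply: G3_sub_G; apply: graftw_G3.
have GY : G (graftw u (spread h')) by apply: G3_sub_G; apply: graftw_G3.
have Nz : N [~ [~ graftw u K, g], graftw u (spread h')].
  have NXg : N [~ graftw u K, g].
    rewrite commgEr; apply: (is_subgroupM sN) => //.
    by apply: NJ => //; apply: (is_subgroupV sN).
  by rewrite commgEl; apply: (is_subgroupM sN); [apply: (is_subgroupV sN) | apply: NJ].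
have cX k1 : [~ graftw u k1, graftw u K ^ g] = 1.
  by apply/eqP/commgP/commute_sym/graftw_commute.
have cY : [~ graftw u K ^ g, graftw u (spread h')] = 1.
  exact/eqP/commgP/graftw_commute.
move: Nz; rewrite [X in [~ X, _]]commgEl commgMl cY mulg1 graftwV graftwR.
have /eqP/conjg_fixP -> := cX [~ K^-1, spread h'].
by rewrite graftw_cat /= !graftV invgK !graft_spreadR h'0 graft_spreadR h0.
Qed.

Lemma normal_graft_G4 g u v k : N g -> g u <> u -> size v = (size u).+2 -> G4 k ->
  N (graftw v k).
Proof.
move=> Ng gu sv G4k.
have H : G4 `<=` [set k | N (graftw (u ++ [:: 0%R; 0%R]) k)].
  apply: comm_sub_le; first exact: (graftw_preim _ sN).
  by move=> x y G3x Gy; exact: (normal_graft_comm Ng gu G3x Gy).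
have [|f [f' [Gf Gf' E]]] := @graftw_transport (u ++ [:: 0%R; 0%R]) v.
  by rewrite size_cat sv addn2.
rewrite -(conjgKV f' k) -E; apply: NJ => //; apply: H.
by case/is_normalE: nG4 => _ _ J4; apply: J4 => //; apply: (is_subgroupV sG).
Qed.

Lemma normal_level_stab g : N g -> g <> 1 -> exists n, G `&` level_stab n `<=` N.
Proof.
move=> Ng g1; have [u gu] : exists u, g u <> u.
  by apply: contra_notP g1 => /forallNP H; apply: tree_autP => w; apply: contrapT (H w).
(* Two levels for the letters 00, and three because st_G(3) lies in gamma_4(G). *)
exists (size u).+2.+3.
(* Induction on the number of levels from [v] down to level [(size u).+2], splitting [k] into its
   sections. *)
have H (n : nat) v k : size v + n = (size u).+2 -> (G `&` level_stab n.+3) k -> N (graftw v k).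
  elim: n v k => [|n IH] v k sv [Gk km].
    apply: (normal_graft_G4 Ng gu); first by rewrite -sv addn0.
    by apply: (level_stab3_G4 p_prime p_odd eps_nc).
  have [l E] := ggs_group_st1 Gk (level_stab_mono (isT : 1 <= n.+4) km).
  rewrite bbs_spread in E; rewrite E in Gk km *.
  apply: (spread_graft_mem sN) => x; apply: IH; first by rewrite size_rcons addSnnS.
  by split; [apply: spread_section_mem Gk | apply: level_stab_spread km].
by move=> k; apply: (H _ [::]).
Qed.

End Normal.
End NormalSubgroups.

(** * Finite index, pigeonhole and normal cores *)

Section FiniteIndex.
Context {T : groupType}.
Implicit Types (G H N : set T) (x y g : T).

Lemma coset_eq H x y : is_subgroup H ->
  [set x * h | h in H] = [set y * h | h in H] <-> H (x^-1 * y).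
Proof.
move=> sH; split=> [E | Hxy].
  have : [set y * h | h in H] y by exists 1; [apply: is_subgroup1 | rewrite mulg1].
  by rewrite -E => -[h Hh <-]; rewrite mulKg.
apply/seteqP; split=> _ [h Hh <-].
  exists ((x^-1 * y)^-1 * h); last by rewrite invgM invgK !mulgA mulgV mul1g.
  by apply: is_subgroupM => //; apply: is_subgroupV.
by exists (x^-1 * y * h); [apply: is_subgroupM | rewrite !mulgA mulgV mul1g].
Qed.

Lemma finite_cosets G N (F : finType) (phi : T -> F) : is_subgroup N ->
  (forall g g', G g -> G g' -> phi g = phi g' -> N (g^-1 * g')) ->
  finite_set (cosets G N).
Proof.
move=> sN H; pose r t := xget 1 [set g | G g /\ phi g = t].
have : finite_set [set [set r t * h | h in N] | t in [set: F]].
  exact/finite_image/finite_finset.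
apply: sub_finite_set => _ [g Gg <-]; exists (phi g) => //.
have [Gr phir] := @xgetI _ 1 [set g' | G g' /\ phi g' = phi g] g (conj Gg erefl).
by apply/coset_eq => //; apply: H.
Qed.

Lemma infinite_pigeonhole G (F : finType) (phi : T -> F) : infinite_set G ->
  exists g g', [/\ G g, G g', g <> g' & phi g = phi g'].
Proof.
move=> Ginf; apply: contrapT => H; apply: Ginf.
have inj : {in G &, injective phi}.
  move=> g g' /set_mem Gg /set_mem Gg' E; apply: contrapT => ne.
  by apply: H; exists g, g'.
rewrite -(eq_finite_set (inj_card_eq inj)).
by apply: (@sub_finite_set _ _ [set: F]) => //; apply: finite_finset.
Qed.

Definition normal_core G H : set T := [set x | G x /\ forall y, G y -> H (x ^ y)].

Lemma normal_core_normal G H : is_subgroup G -> is_subgroup H -> is_normal G (normal_core G H).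
Proof.
move=> sG sH; apply/is_normalE; split.
- apply: is_subgroup_ind => /= [|x x' [Gx Hx] [Gx' Hx']|x [Gx Hx]].
  + by split=> [|y Gy]; rewrite ?conj1g; apply: is_subgroup1.
  + split=> [|y Gy]; first exact: is_subgroupM.
    by rewrite conjMg; apply: is_subgroupM => //; [apply: Hx | apply: Hx'].
  + split=> [|y Gy]; first exact: is_subgroupV.
    by rewrite conjVg; apply: is_subgroupV => //; apply: Hx.
- by move=> x [].
- move=> g x Gg [Gx Hx]; split=> [|y Gy]; first exact: is_subgroupJ.
  by rewrite -conjgM; apply: Hx; apply: is_subgroupM.
Qed.

Lemma normal_core_sub G H : is_subgroup G -> normal_core G H `<=` H.
Proof. by move=> sG x [Gx /(_ 1 (is_subgroup1 sG))]; rewrite conjg1. Qed.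

(* Two elements permuting the finitely many cosets in the same way differ by
   an element of the core. *)
Lemma normal_core_nontrivial G H : is_subgroup G -> is_subgroup H ->
  infinite_set G -> finite_index G H -> exists2 x, normal_core G H x & x <> 1.
Proof.
move=> sG sH Ginf /finite_seqP[s sE].
pose c x := [set x * h | h in H].
have cs y : G y -> c y \in s.
  by move=> Gy; have : [set` s] (c y) by rewrite -sE; exists y.
pose r i := xget 1 [set y | G y /\ c y = nth set0 s i].
(* The extra value in the codomain is what [index] returns for an absent coset, so [inord] loses
   nothing. *)
pose phi g := [ffun i : 'I_(size s) => inord (index (c (g * r i)) s) : 'I_(size s).+1].
have [g [g' [Gg Gg' gg' E]]] := infinite_pigeonhole phi Ginf.
have Gx : G (g^-1 * g') by apply: is_subgroupM => //; apply: is_subgroupV.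
exists (g^-1 * g'); last first.
  by move=> /(congr1 (fun z => g * z)); rewrite mulVKg mulg1 => /esym.
split=> // y Gy.
have ltys : index (c y) s < size s by rewrite index_mem cs.
pose i := Ordinal ltys.
have [Gr cr] := @xgetI _ 1 [set z | G z /\ c z = nth set0 s i] y
  (conj Gy (esym (nth_index set0 (cs y Gy)))).
have := congr1 (fun f : {ffun _} => f i) E; rewrite !ffunE => /(congr1 val) /=.
rewrite !inordK ?ltnS ?index_size // => Ei.
have Hr : H ((r i)^-1 * y).
  by apply/coset_eq => //; rewrite [LHS]cr /= nth_index // cs.
have Hx : H ((g^-1 * g') ^ r i).
  have /(coset_eq _ _ sH) : c (g * r i) = c (g' * r i).
    rewrite -[LHS](nth_index set0 (cs _ _)) ?Ei ?nth_index //.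
    - by apply: cs; apply: is_subgroupM.
    - by apply: is_subgroupM.
  by rewrite invgM conjgE !mulgA.
by have := is_subgroupJ sH Hx Hr; rewrite -conjgM mulVKg.
Qed.

End FiniteIndex.

Lemma finite_cosets_level_stab p (G N : set (tree_aut p)) n : is_subgroup G ->
  is_subgroup N -> G `&` level_stab n `<=` N -> finite_set (cosets G N).
Proof.
move=> sG sN GN.
(* The action on L_n; the default [t] is never taken, as automorphisms preserve length. *)
pose phi (g : tree_aut p) := [ffun t : n.-tuple 'I_p => insubd t (g t) : n.-tuple 'I_p].
apply: (finite_cosets (phi := phi)) => // g g' Gg Gg' E; apply: GN; split.
  by apply: (is_subgroupM sG) => //; apply: (is_subgroupV sG).
move=> w wn; have wt : size w == n by apply/eqP.
have := congr1 (fun f : {ffun n.-tuple 'I_p -> n.-tuple 'I_p} => val (f (Tuple wt))) E.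
rewrite !ffunE !val_insubd !size_aut /= wt => gw.
by rewrite -[RHS](aut_KV g) gw.
Qed.

(** * Infinitude of G and the conclusion *)

Section GGSInfinite.
Variable q : nat.
Local Notation p := q.+2.
Variable e : 'rV['F_p]_p.-1.
Hypotheses (p_prime : prime p).
Local Notation G := (ggs_group e).

Lemma eps_nonconstant : nonconstant e ->
  exists x y, [/\ x != 0%R, y != 0%R & ggs_eps e x != ggs_eps e y].
Proof.
move=> e_nc; apply: contra_notP e_nc => H i j.
have epsE (k : 'I_q.+1) : ggs_eps e (lift ord0 k) = (e ord0 k : nat) :> nat.
  rewrite /ggs_eps /= (_ : inord _ = k); last exact: inord_val.
  by rewrite modn_small // -[X in _ < X](Fp_cast p_prime) ltn_ord.
apply/val_inj; rewrite /= -!epsE; congr nat_of_ord.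
by apply/eqP; apply: contra_notT H => ne; exists (lift ord0 i), (lift ord0 j).
Qed.

Hypothesis eps_nc : exists x y, [/\ x != 0%R, y != 0%R & ggs_eps e x != ggs_eps e y].

(** Lifting a repeatedly along the letter 0 yields elements whose first moved vertex on the ray
    000... lies at any prescribed depth. *)
Lemma ggs_infinite : infinite_set G.
Proof.
pose P n (g : tree_aut p) := [/\ G g, forall i, i <= n -> g (nseq i ord0) = nseq i ord0
  & g (nseq n.+1 ord0) <> nseq n.+1 ord0].
have exP n : exists g, P n g.
  elim: n => [|n [g [Gg g1 g2]]].
    exists (ggs_a p); split; first exact: ggs_group_a.
      by case=> // _; rewrite aut_root.
    by move=> /(congr1 (fun w => nat_of_ord (head ord0 w))); rewrite /= modn_small.
  have [h [Gh h0]] := section_ex p_prime eps_nc 0%R Gg.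
  exists (spread h); split=> // [[|i] lein|]; first by rewrite aut_root.
    by rewrite -[nseq _ _]/(ord0 :: nseq i ord0) spreadE h0 g1.
  by rewrite -[nseq n.+2 _]/(ord0 :: nseq n.+1 ord0) spreadE h0 => -[].
have [f fP] := choice exP.
have f_inj : injective f.
  move=> m n; wlog lt_mn : m n / m < n => [W|E].
    by case: (ltngtP m n) => // lt E; [|symmetry]; apply: W.
  have [_ _ Hm] := fP m; have [_ Hn _] := fP n.
  by rewrite E in Hm; case: Hm; apply: Hn.
move=> Gfin; apply: infinite_nat.
rewrite -(eq_finite_set (inj_card_eq (in2W f_inj))).
by apply: sub_finite_set Gfin => _ [n _ <-]; case: (fP n).
Qed.

End GGSInfinite.

Theorem theorem2p7 (p : nat) (p_prime : prime p) (p_odd : odd p)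
    (e : 'rV['F_p]_p.-1) (e_nonconstant : nonconstant e) :
  congruence_subgroup_property (ggs_group e) /\ just_infinite (ggs_group e).
Proof.
(* The form [q.+2] gives ['I_p] its ring structure. *)
case: p p_prime p_odd e e_nonconstant => [|[|q]] // p_prime p_odd e e_nc.
have eps_nc := eps_nonconstant p_prime e_nc.
have sG := ggs_subgroup e.
have Ginf := ggs_infinite p_prime eps_nc.
have stN N x : is_normal (ggs_group e) N -> N x -> x <> 1 ->
    exists n, ggs_group e `&` level_stab n `<=` N.
  by move=> nN; apply: normal_level_stab.
split=> [H sH HG Hfin | ].
  have [x cx x1] := normal_core_nontrivial sG sH Ginf Hfin.
  have [n Hn] := stN _ _ (normal_core_normal sG sH) cx x1.
  by exists n => g /Hn/(normal_core_sub sG).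
split=> // N nN N1; have [sN _ _] := nN.
have [x Nx x1] : exists2 x, N x & x <> 1.
  apply: contra_notP N1 => H; apply/seteqP; split=> [x Nx | _ ->].
    by apply: contrapT => x1; apply: H; exists x.
  exact: is_subgroup1 sN.
have [n Hn] := stN _ _ nN Nx x1.
exact: finite_cosets_level_stab sG sN Hn.
Qed.
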